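(* In the setting given in the context, for any $t\ge0$ and $y\in[Y_0(t),Y_L(t)]$, $$\frac{\partial u(t,y)}{\partial t}+u(t,y)\frac{\partial u(t,y)}{\partial y}=(\omega')^2\frac{1}{\rho(t,y)}\frac{\partial}{\partial y}\frac{1}{\rho(t,y)}=-\frac{1}{\rho(t,y)}\frac{\partial p(t,y)}{\partial y},$$ where $$p(t,y)=-\frac{(\omega')^2}{\rho(t,y)}+C$$ and $C$ is a constant.
   Context: Setting. Fix $0<r<1$, $\omega'>0$, $v\in\mathbb{R}$ and $X,V\in C^4([0,1])$ with $X>0$, $X(0)=X(1)=1$, $V(0)=V(1)=0$. Put $\alpha=\int_0^1|X''(y)|dy$, $\beta=\int_0^1|V''(y)|dy$, $\gamma=2\alpha+\beta/\omega'$ and assume $\gamma<\min(r,\frac{1-r}{2})$. $q(t,x)$, $t\ge0$, $x\in[0,1]$, is the solution of the wave equation $q_{tt}=(\omega')^2q_{xx}$ with boundary conditions $q(t,0)=q(t,1)=0$ and initial conditions $q(0,x)=X(x)-1$, $q_t(0,x)=V(x)$ (in general the $C^1$ generalized solution given by d'Alembert's formula applied to the odd 2-periodic extensions of $X-1$ and $V$; it coincides with the classical solution whenever the latter exists). $G(t,0)=vt+(\omega')^2\int_0^t(t-s)q_x(s,0)\,ds$ and $G(t,z)=G(t,0)+z+\int_0^zq(t,x')\,dx'$ for $z\in[0,1]$, $t\ge0$. $L=\int_0^1X(y)\,dy$; for $x\in[0,L]$, $z(x)\in[0,1]$ is uniquely defined by $\int_0^{z(x)}X(x')\,dx'=x$.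 The trajectory of the continuum particle $x\in[0,L]$ is $y(t,x)=G(t,z(x))$; $Y_0(t)=y(t,0)$, $Y_L(t)=y(t,L)$. For each $t\ge0$ the particles do not collide: $x\mapsto y(t,x)$ is a strictly increasing bijection of $[0,L]$ onto $[Y_0(t),Y_L(t)]$; its inverse is denoted $x(t,y)$, i.e. $y(t,x(t,y))=y$. The velocity $u$ is defined by $u(t,y(t,x))=\frac{\partial y(t,x)}{\partial t}$. Let $F(t,y)=z(x(t,y))$; the density is $\rho(t,y)=\frac{\partial F(t,y)}{\partial y}$. At boundary points of $\{(t,y):t\ge0,\ Y_0(t)\le y\le Y_L(t)\}$ derivatives are understood as the continuous extensions of the derivatives from the interior. *)

(* Defs.v *)
From Stdlib Require Import Reals ClassicalEpsilon.
From Coquelicot Require Import Coquelicot.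
Open Scope R_scope.

(* One-variable differentiation relative to a set: at an endpoint of an
   interval this is the one-sided derivative. *)
Definition is_deriv_on (D : R -> Prop) (f : R -> R) (x l : R) : Prop :=
  filterdiff f (within D (locally x)) (fun h => scal h l).

Definition deriv_on (D : R -> Prop) (f : R -> R) (x : R) : R :=
  epsilon (inhabits 0) (is_deriv_on D f x).

Fixpoint C_on (n : nat) (D : R -> Prop) (f : R -> R) : Prop :=
  match n with
  | O => continuous_on D f
  | S m => (forall x, D x -> exists l, is_deriv_on D f x l)
           /\ C_on m D (deriv_on D f)
  end.

(* Partial derivatives of f(t,y) on a planar set D: ordinary partial
   derivatives at interior points; at the other points, the limit of the
   partial derivative from the interior (continuous extension). *)
Definition int_of (D : R * R -> Prop) (p : R * R) : Prop := locally p D.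

Definition interior_or_limit (D : R * R -> Prop) (d : R * R -> R -> Prop)
    (p : R * R) (l : R) : Prop :=
  (int_of D p -> d p l) /\
  (~ int_of D p ->
     exists g : R * R -> R,
       within (int_of D) (locally p) (fun p' => d p' (g p')) /\
       filterlim g (within (int_of D) (locally p)) (locally l)).

Definition is_d_dt (D : R * R -> Prop) (f : R -> R -> R) (t y l : R) : Prop :=
  interior_or_limit D
    (fun p => is_derive (fun s => f s (snd p)) (fst p)) (t, y) l.

Definition is_d_dy (D : R * R -> Prop) (f : R -> R -> R) (t y l : R) : Prop :=
  interior_or_limit D
    (fun p => is_derive (fun s => f (fst p) s) (snd p)) (t, y) l.

Definition d_dy (D : R * R -> Prop) (f : R -> R -> R) (t y : R) : R :=
  epsilon (inhabits 0) (is_d_dy D f t y).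

(* Meaningful for y in f([a,b]) when f is injective on [a,b]. *)
Definition inverse_on (a b : R) (f : R -> R) (y : R) : R :=
  epsilon (inhabits 0) (fun x => a <= x <= b /\ f x = y).

Definition I01 (x : R) : Prop := 0 <= x <= 1.

Definition alpha_X (X : R -> R) : R :=
  RInt (fun y => Rabs (deriv_on I01 (deriv_on I01 X) y)) 0 1.

Definition beta_V (V : R -> R) : R :=
  RInt (fun y => Rabs (deriv_on I01 (deriv_on I01 V) y)) 0 1.

Definition gamma_XV (w : R) (X V : R -> R) : R := 2 * alpha_X X + beta_V V / w.

(* Odd 2-periodic extension of f from [0,1]; s is first translated by an even
   integer into [-1,1). *)
Definition odd_periodic (f : R -> R) (s : R) : R :=
  let s' := s - 2 * IZR (Int_part ((s + 1) / 2)) in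
  if Rle_dec 0 s' then f s' else - f (- s').

(* d'Alembert's formula for q_tt = w^2 q_xx, q(t,0) = q(t,1) = 0,
   q(0,x) = X(x) - 1, q_t(0,x) = V(x). *)
Definition qsol (w : R) (X V : R -> R) (t x : R) : R :=
  let phi := odd_periodic (fun s => X s - 1) in
  let psi := odd_periodic V in
  (phi (x + w * t) + phi (x - w * t)) / 2
  + RInt psi (x - w * t) (x + w * t) / (2 * w).

(* G(t,0). *)
Definition posG0 (w v : R) (X V : R -> R) (t : R) : R :=
  v * t
  + w ^ 2 * RInt (fun s => (t - s) * deriv_on I01 (qsol w X V s) 0) 0 t.

Definition posG (w v : R) (X V : R -> R) (t z : R) : R :=
  posG0 w v X V t + z + RInt (qsol w X V t) 0 z.

Definition length_L (X : R -> R) : R := RInt X 0 1.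

(* z(x), the inverse of z |-> int_0^z X on [0,1]. *)
Definition zeta (X : R -> R) : R -> R :=
  inverse_on 0 1 (fun z => RInt X 0 z).

(* y(t,x) = G(t, z(x)). *)
Definition traj (w v : R) (X V : R -> R) (t x : R) : R :=
  posG w v X V t (zeta X x).

Definition Y0 (w v : R) (X V : R -> R) (t : R) : R := traj w v X V t 0.
Definition YL (w v : R) (X V : R -> R) (t : R) : R := traj w v X V t (length_L X).

Definition spacetime (w v : R) (X V : R -> R) (p : R * R) : Prop :=
  0 <= fst p /\ Y0 w v X V (fst p) <= snd p <= YL w v X V (fst p).

(* x(t,y), the inverse of x |-> y(t,x). *)
Definition particle (w v : R) (X V : R -> R) (t : R) : R -> R :=
  inverse_on 0 (length_L X) (traj w v X V t).

(* u(t, y(t,x)) = dy(t,x)/dt, taken at x = x(t,y); one-sided at t = 0. *)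
Definition velocity (w v : R) (X V : R -> R) (t y : R) : R :=
  deriv_on (Rle 0) (fun s => traj w v X V s (particle w v X V t y)) t.

Definition labelF (w v : R) (X V : R -> R) (t y : R) : R :=
  zeta X (particle w v X V t y).

Definition density (w v : R) (X V : R -> R) : R -> R -> R :=
  d_dy (spacetime w v X V) (labelF w v X V).

Definition pressure (w v : R) (X V : R -> R) (C t y : R) : R :=
  - w ^ 2 / density w v X V t y + C.

(* Main.v *)
Require Import Defs.
From Stdlib Require Import Reals Lra Lia ClassicalEpsilon.
From Coquelicot Require Import Coquelicot.
Open Scope R_scope.

(** d'Alembert's formula makes the flow a sum of a drift and two travelling
    waves, [G(t,z) = v t + z + A(z + w t) + B(z - w t)] with [A], [B] of class
    [C^2] on the whole line, so [G_tt = w^2 G_zz]; and [gamma < 1/2] gives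
    [G_z >= 1/2] everywhere. Hence [G(t,.)] has an inverse [Z(t,.)] on the whole
    line, which is [C^1] in both variables, and on the space-time domain
    [1/rho = G_z(t,Z)] and [u = G_t(t,Z)] are restrictions of global [C^1]
    functions. The chain rule with [Z_t = - G_t / G_z], [Z_y = 1 / G_z] turns
    [u_t + u u_y] into [G_tt(t,Z)] and [(1/rho) (1/rho)_y] into [G_zz(t,Z)]. *)

(** * Derivatives relative to a set *)

(** The conditions X = 1 and V = 0 at the endpoints make the odd extensions of X - 1 and V of class
    C^1. The waves [A] and [B] integrate the first once and the second twice, which is where their
    two continuous derivatives come from, although q itself may be only a generalized solution. The
    bound on the stretch comes from controlling the two waves separately: |X - 1| is at most alpha
    and every primitive of the extended V from 0 is at most beta, so the stretch is at least 1 -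
    alpha - beta/w, hence at least 1 - gamma. The delicate points are the edges of the space-time
    domain, where derivatives are limits from the interior. A formula that is continuous on the
    whole plane settles interior and edge points at once. Conversely, the density is an epsilon
    choice, so identifying it requires that interior points accumulate at every point of the domain,
    corners included. *)

Lemma is_derive_iff (f : R -> R) (x l : R) :
  is_derive f x l <->
  forall eps : posreal, exists delta : posreal, forall y,
    Rabs (y - x) < delta -> Rabs (f y - f x - l * (y - x)) <= eps * Rabs (y - x).
Proof.
split.
- intros [_ H] eps.
  destruct (H x (fun P HP => HP) eps) as [d Hd].
  exists d; intros y Hy.
  specialize (Hd y Hy).
  change (Rabs (f y - f x - (y - x) * l) <= eps * Rabs (y - x)) in Hd.
  now rewrite (Rmult_comm l).
- intros H; split; [apply is_linear_scal_l|].
  intros x' Hx' eps.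
  rewrite <- (is_filter_lim_locally_unique _ _ Hx'); clear x' Hx'.
  destruct (H eps) as [d Hd].
  exists d; intros y Hy.
  change (Rabs (f y - f x - (y - x) * l) <= eps * Rabs (y - x)).
  rewrite (Rmult_comm _ l); now apply Hd.
Qed.

Lemma is_deriv_on_iff (D : R -> Prop) (f : R -> R) (x l : R) : D x ->
  (is_deriv_on D f x l <->
   forall eps : posreal, exists delta : posreal, forall y, D y ->
     Rabs (y - x) < delta -> Rabs (f y - f x - l * (y - x)) <= eps * Rabs (y - x)).
Proof.
intros Dx; split.
- intros [_ H] eps.
  destruct (H x) with (eps := eps) as [d Hd]; [intros P HP; now apply filter_le_within|].
  exists d; intros y Dy Hy.
  specialize (Hd y Hy Dy).
  change (Rabs (f y - f x - (y - x) * l) <= eps * Rabs (y - x)) in Hd.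
  now rewrite (Rmult_comm l).
- intros H; split; [exact (is_linear_scal_l (K := R_AbsRing) (V := R_NormedModule) l)|].
  intros x' Hx' eps.
  (* [filterdiff] speaks of every limit [x'] of the filter. Since [x] lies in [D], each set of the
     relative filter contains [x], so [x] is in every ball around [x']. *)
  assert (E : x = x').
  { apply eq_close; intros e.
    apply ball_sym.
    assert (K := Hx' _ (locally_ball x' e)).
    exact (locally_singleton _ _ K Dx). }
  subst x'; destruct (H eps) as [d Hd].
  exists d; intros y Hy Dy.
  change (Rabs (f y - f x - (y - x) * l) <= eps * Rabs (y - x)).
  rewrite (Rmult_comm _ l); now apply Hd.
Qed.

Lemma is_derive_deriv_on (D : R -> Prop) (f : R -> R) (x l : R) :
  D x -> is_derive f x l -> is_deriv_on D f x l.
Proof.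
intros Dx H; apply is_deriv_on_iff; auto; intros eps.
destruct (proj1 (is_derive_iff f x l) H eps) as [d Hd]; exists d; auto.
Qed.

Lemma is_deriv_on_ext (D : R -> Prop) (f g : R -> R) (x l : R) :
  D x -> (forall y, D y -> f y = g y) -> is_deriv_on D f x l -> is_deriv_on D g x l.
Proof.
intros Dx E H; apply is_deriv_on_iff; auto; intros eps.
destruct (proj1 (is_deriv_on_iff D f x l Dx) H eps) as [d Hd]; exists d.
intros y Dy Hy; rewrite <- !E by auto; auto.
Qed.

Lemma is_deriv_on_unique (D : R -> Prop) (f : R -> R) (x l1 l2 : R) :
  D x -> (forall d : posreal, exists y, D y /\ y <> x /\ Rabs (y - x) < d) ->
  is_deriv_on D f x l1 -> is_deriv_on D f x l2 -> l1 = l2.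
Proof.
intros Dx Hacc H1 H2.
destruct (Req_dec l1 l2) as [|Hn]; auto; exfalso.
(* With a quarter of the gap, the two errors add up to at most half of |l1 - l2| |y - x|, yet by the
   triangle inequality they must cover all of it. *)
assert (He : 0 < Rabs (l1 - l2) / 4) by (assert (0 < Rabs (l1 - l2)) by (apply Rabs_pos_lt; lra); lra).
set (eps := mkposreal _ He).
destruct (proj1 (is_deriv_on_iff D f x l1 Dx) H1 eps) as [d1 Hd1].
destruct (proj1 (is_deriv_on_iff D f x l2 Dx) H2 eps) as [d2 Hd2].
destruct (Hacc (mkposreal _ (Rmin_pos d1 d2 (cond_pos d1) (cond_pos d2)))) as (y & Dy & Hyx & Hy); simpl in Hy.
assert (A1 := Hd1 y Dy (Rlt_le_trans _ _ _ Hy (Rmin_l _ _))).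
assert (A2 := Hd2 y Dy (Rlt_le_trans _ _ _ Hy (Rmin_r _ _))).
simpl in A1, A2.
assert (P : 0 < Rabs (y - x)) by (apply Rabs_pos_lt; lra).
assert (T : Rabs ((l1 - l2) * (y - x)) <= Rabs (f y - f x - l2 * (y - x)) + Rabs (f y - f x - l1 * (y - x))).
{ replace ((l1 - l2) * (y - x)) with ((f y - f x - l2 * (y - x)) - (f y - f x - l1 * (y - x))) by ring.
  unfold Rminus at 1; eapply Rle_trans; [apply Rabs_triang|]; rewrite Rabs_Ropp; lra. }
rewrite Rabs_mult in T.
assert (0 < Rabs (l1 - l2) * Rabs (y - x)) by (apply Rmult_lt_0_compat; lra).
lra.
Qed.

Lemma deriv_on_spec (D : R -> Prop) (f : R -> R) (x : R) :
  (exists l, is_deriv_on D f x l) -> is_deriv_on D f x (deriv_on D f x).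
Proof. intros H; exact (epsilon_spec (inhabits 0) _ H). Qed.

Lemma deriv_on_eq (D : R -> Prop) (f : R -> R) (x l : R) :
  D x -> (forall d : posreal, exists y, D y /\ y <> x /\ Rabs (y - x) < d) ->
  is_deriv_on D f x l -> deriv_on D f x = l.
Proof.
intros Dx Hacc H.
apply (is_deriv_on_unique D f x); auto.
apply deriv_on_spec; eauto.
Qed.

(** Serves at the junctions of piecewise functions, where both sides have the same slope. Taking
    [D1] equal to [D2] covers points interior to one piece. *)
Lemma is_deriv_on_glue (D1 D2 : R -> Prop) (f : R -> R) (x l : R) :
  D1 x -> D2 x -> locally x (fun y => D1 y \/ D2 y) ->
  is_deriv_on D1 f x l -> is_deriv_on D2 f x l -> is_derive f x l.
Proof.
intros H1 H2 [d Hd] K1 K2; apply is_derive_iff; intros eps.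
destruct (proj1 (is_deriv_on_iff D1 f x l H1) K1 eps) as [d1 Hd1].
destruct (proj1 (is_deriv_on_iff D2 f x l H2) K2 eps) as [d2 Hd2].
assert (P : 0 < Rmin d (Rmin d1 d2)).
{ repeat apply Rmin_pos; apply cond_pos. }
exists (mkposreal _ P); simpl; intros y Hy.
assert (A := Rlt_le_trans _ _ _ Hy (Rmin_l _ _)).
assert (B := Rlt_le_trans _ _ _ Hy (Rmin_r _ _)).
destruct (Hd y A) as [Dy|Dy].
- apply Hd1; auto; exact (Rlt_le_trans _ _ _ B (Rmin_l _ _)).
- apply Hd2; auto; exact (Rlt_le_trans _ _ _ B (Rmin_r _ _)).
Qed.

Lemma is_deriv_on_reflect (D : R -> Prop) (g : R -> R) (c x l : R) :
  D x -> is_deriv_on D g x l ->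
  is_deriv_on (fun s => D (c - s)) (fun s => - g (c - s)) (c - x) l.
Proof.
intros Dx H.
assert (Dc : D (c - (c - x))) by (now replace (c - (c - x)) with x by ring).
apply is_deriv_on_iff; auto; intros eps.
destruct (proj1 (is_deriv_on_iff D g x l Dx) H eps) as [d Hd]; exists d.
intros y Dy Hy.
assert (E : Rabs (c - y - x) = Rabs (y - (c - x))).
{ rewrite <- Rabs_Ropp; f_equal; ring. }
assert (K := Hd (c - y) Dy); rewrite E in K; specialize (K Hy).
replace (c - (c - x)) with x by ring.
rewrite <- Rabs_Ropp.
replace (- (- g (c - y) - - g x - l * (y - (c - x)))) with (g (c - y) - g x - l * (c - y - x)) by ring.
exact K.
Qed.

(** * Extension of functions from the unit interval to the line *)

Definition clamp (s : R) : R := Rmax 0 (Rmin s 1).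

Lemma clamp_I01 (s : R) : I01 (clamp s).
Proof. unfold I01, clamp, Rmax, Rmin; repeat destruct Rle_dec; lra. Qed.

Lemma clamp_id (s : R) : I01 s -> clamp s = s.
Proof. unfold I01, clamp, Rmax, Rmin; repeat destruct Rle_dec; lra. Qed.

Lemma clamp_left (s : R) : s <= 0 -> clamp s = 0.
Proof. unfold clamp, Rmax, Rmin; repeat destruct Rle_dec; lra. Qed.

Lemma clamp_right (s : R) : 1 <= s -> clamp s = 1.
Proof. unfold clamp, Rmax, Rmin; repeat destruct Rle_dec; lra. Qed.

Lemma clamp_lipschitz (a b : R) : Rabs (clamp a - clamp b) <= Rabs (a - b).
Proof. unfold clamp, Rmax, Rmin; repeat destruct Rle_dec; unfold Rabs; repeat destruct Rcase_abs; lra. Qed.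

(** Turns relative continuity into continuity on the whole line; it is applied to both 1-Lipschitz
    maps of the line onto [0,1], [clamp] and the folding map [triangle_wave]. *)
Lemma continuous_on_comp_lipschitz (D : R -> Prop) (f k : R -> R) (x : R) :
  (forall s, D (k s)) -> (forall a b, Rabs (k a - k b) <= Rabs (a - b)) ->
  continuous_on D f -> continuous (fun s => f (k s)) x.
Proof.
intros HD Hk Hf P HP.
destruct (Hf (k x) (HD x) P HP) as [d Hd].
exists d; intros y Hy; apply (Hd (k y)); auto.
exact (Rle_lt_trans _ _ _ (Hk y x) Hy).
Qed.

Lemma continuous_clamp (f : R -> R) (x : R) :
  continuous_on I01 f -> continuous (fun s => f (clamp s)) x.
Proof.
apply continuous_on_comp_lipschitz; [apply clamp_I01 | apply clamp_lipschitz].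
Qed.

Lemma is_deriv_on_continuous_on (D : R -> Prop) (f f1 : R -> R) :
  (forall x, D x -> is_deriv_on D f x (f1 x)) -> continuous_on D f.
Proof.
intros H x Dx.
apply filterlim_locally; intros eps.
(* Tolerance 1 gives the local bound |f y - f x| <= (1 + |f1 x|) |y - x|. *)
destruct (proj1 (is_deriv_on_iff D f x (f1 x) Dx) (H x Dx) (mkposreal 1 Rlt_0_1)) as [d Hd].
simpl in Hd.
assert (P : 0 < eps / (1 + Rabs (f1 x))).
{ apply Rdiv_lt_0_compat; [apply cond_pos|]; generalize (Rabs_pos (f1 x)); lra. }
exists (mkposreal _ (Rmin_pos _ _ (cond_pos d) P)); simpl; intros y Hy Dy.
assert (A := Hd y Dy (Rlt_le_trans _ _ _ Hy (Rmin_l _ _))).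
assert (B := Rlt_le_trans _ _ _ Hy (Rmin_r _ _)).
change (Rabs (f y - f x) < eps).
change (Rabs (y - x) < eps / (1 + Rabs (f1 x))) in B.
apply Rlt_div_r in B; [|generalize (Rabs_pos (f1 x)); lra].
replace (f y - f x) with ((f y - f x - f1 x * (y - x)) + f1 x * (y - x)) by ring.
eapply Rle_lt_trans; [apply Rabs_triang|]; rewrite Rabs_mult; lra.
Qed.

(** Continuation along the tangent lines at the endpoints. It is differentiable on the whole line,
    so mean value and integration theorems apply up to the endpoints of [0,1]. *)
Definition C1_extension (f f1 : R -> R) (s : R) : R :=
  f (clamp s) + f1 (clamp s) * (s - clamp s).

Lemma C1_extension_eq (f f1 : R -> R) (s : R) : I01 s -> C1_extension f f1 s = f s.
Proof. intros H; unfold C1_extension; rewrite clamp_id by auto; ring. Qed.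

Lemma is_derive_C1_extension (f f1 : R -> R) (x : R) :
  (forall s, I01 s -> is_deriv_on I01 f s (f1 s)) ->
  is_derive (C1_extension f f1) x (f1 (clamp x)).
Proof.
intros H.
assert (M : forall s, I01 s -> is_deriv_on I01 (C1_extension f f1) s (f1 (clamp s))).
{ intros s Hs; rewrite clamp_id by auto.
  apply (is_deriv_on_ext I01 f); auto.
  intros; symmetry; apply C1_extension_eq; auto. }
(* Where the clamp is constant, that is on each outer half-line, the extension is affine. *)
assert (Aff : forall (D : R -> Prop) c s, (forall y, D y -> clamp y = c) -> D s ->
   is_deriv_on D (C1_extension f f1) s (f1 (clamp s))).
{ intros D c s Hc Ds; rewrite (Hc s Ds).
  apply (is_deriv_on_ext D (fun y => f c + f1 c * (y - c))); auto.
  - intros y Dy; unfold C1_extension; now rewrite (Hc y Dy).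
  - apply is_derive_deriv_on; auto; auto_derive; auto; ring. }
assert (L : forall s, s <= 0 -> is_deriv_on (fun y => y <= 0) (C1_extension f f1) s (f1 (clamp s))).
{ intros s Hs; apply (Aff _ 0); auto; intros; now apply clamp_left. }
assert (U : forall s, 1 <= s -> is_deriv_on (fun y => 1 <= y) (C1_extension f f1) s (f1 (clamp s))).
{ intros s Hs; apply (Aff _ 1); auto; intros; now apply clamp_right. }
assert (Near : forall D : R -> Prop, (exists d : posreal, forall y, Rabs (y - x) < d -> D y) -> locally x D).
{ intros D [d Hd]; exists d; exact Hd. }
destruct (Rlt_dec x 0) as [h0|h0]; [|destruct (Req_dec x 0) as [e0|n0];
  [|destruct (Rlt_dec x 1) as [h1|h1]; [|destruct (Req_dec x 1) as [e1|n1]]]].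
- apply (is_deriv_on_glue (fun y => y <= 0) (fun y => y <= 0)); try apply L; try lra.
  apply Near; assert (P : 0 < - x) by lra; exists (mkposreal _ P); simpl; intros y Hy.
  apply Rabs_def2 in Hy; lra.
- apply (is_deriv_on_glue (fun y => y <= 0) I01); try apply L; try apply M; try (unfold I01; lra).
  apply Near; exists (mkposreal 1 Rlt_0_1); simpl; intros y Hy.
  apply Rabs_def2 in Hy; unfold I01; lra.
- apply (is_deriv_on_glue I01 I01); try apply M; try (unfold I01; lra).
  apply Near; assert (P : 0 < Rmin x (1 - x)) by (apply Rmin_pos; lra).
  exists (mkposreal _ P); simpl; intros y Hy.
  assert (A := Rmin_l x (1 - x)); assert (B := Rmin_r x (1 - x)).
  apply Rabs_def2 in Hy; unfold I01; lra.
- apply (is_deriv_on_glue I01 (fun y => 1 <= y)); try apply U; try apply M; try (unfold I01; lra).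
  apply Near; exists (mkposreal 1 Rlt_0_1); simpl; intros y Hy.
  apply Rabs_def2 in Hy; unfold I01; lra.
- apply (is_deriv_on_glue (fun y => 1 <= y) (fun y => 1 <= y)); try apply U; try lra.
  apply Near; assert (P : 0 < x - 1) by lra; exists (mkposreal _ P); simpl; intros y Hy.
  apply Rabs_def2 in Hy; lra.
Qed.

(** * Bounds by the total variation of the derivative *)

Lemma ex_RInt_of_continuous (h : R -> R) (a b : R) :
  (forall x, continuous h x) -> ex_RInt h a b.
Proof. intros H; apply (ex_RInt_continuous h); auto. Qed.

Lemma Rabs_RInt_sub_le (h : R -> R) (a b : R) :
  (forall x, continuous h x) -> I01 a -> I01 b ->
  Rabs (RInt h a b) <= RInt (fun s => Rabs (h s)) 0 1.
Proof.
intros Ch.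
assert (Ca : forall x, continuous (fun s => Rabs (h s)) x).
{ intros x; apply continuous_comp; [apply Ch | apply continuous_Rabs]. }
assert (W : forall a b, I01 a -> I01 b -> a <= b ->
  Rabs (RInt h a b) <= RInt (fun s => Rabs (h s)) 0 1).
{ clear a b; intros a b Ha Hb Hab.
  eapply Rle_trans; [apply abs_RInt_le; auto; now apply ex_RInt_of_continuous|].
  rewrite <- (RInt_Chasles (fun s => Rabs (h s)) 0 a 1) by now apply ex_RInt_of_continuous.
  rewrite <- (RInt_Chasles (fun s => Rabs (h s)) a b 1) by now apply ex_RInt_of_continuous.
  unfold plus; simpl.
  assert (0 <= RInt (fun s => Rabs (h s)) 0 a).
  { apply RInt_ge_0; [apply Ha | now apply ex_RInt_of_continuous | intros; apply Rabs_pos]. }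
  assert (0 <= RInt (fun s => Rabs (h s)) b 1).
  { apply RInt_ge_0; [apply Hb | now apply ex_RInt_of_continuous | intros; apply Rabs_pos]. }
  lra. }
intros Ha Hb; destruct (Rle_dec a b) as [Hab|Hab]; [now apply W|].
rewrite <- opp_RInt_swap by now apply ex_RInt_of_continuous.
unfold opp; simpl; rewrite Rabs_Ropp; apply W; auto; lra.
Qed.

(* Rolle gives a zero of [f1]; integrating [f2] from it bounds [f1] by the
   total variation, and one more mean value step bounds [f]. *)
Lemma Rabs_le_RInt_second_deriv (f f1 f2 : R -> R) (x : R) :
  (forall s, I01 s -> is_deriv_on I01 f s (f1 s)) ->
  (forall s, I01 s -> is_deriv_on I01 f1 s (f2 s)) ->
  continuous_on I01 f2 -> f 0 = f 1 -> I01 x ->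
  Rabs (f x - f 0) <= RInt (fun s => Rabs (f2 s)) 0 1.
Proof.
intros H1 H2 C2 E Hx.
set (N := RInt (fun s => Rabs (f2 s)) 0 1).
assert (MV : forall b, I01 b -> exists c, I01 c /\ f b - f 0 = f1 c * b).
{ intros b Hb.
  destruct (MVT_gen (C1_extension f f1) 0 b (fun s => f1 (clamp s))) as (c & Hc & Ec).
  - intros s _; now apply is_derive_C1_extension.
  - intros s _; apply continuity_pt_filterlim.
    apply (ex_derive_continuous (C1_extension f f1)).
    eexists; now apply is_derive_C1_extension.
  - rewrite Rmin_left, Rmax_right in Hc by apply Hb.
    assert (Ic : I01 c) by (unfold I01 in *; lra).
    exists c; split; auto.
    rewrite !C1_extension_eq in Ec by (auto; unfold I01; lra).
    rewrite clamp_id in Ec by auto; rewrite Ec; ring. }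
destruct (MV 1) as (c & Hc & Ec); [unfold I01; lra|].
assert (Fc : f1 c = 0) by lra.
assert (CC : forall s, continuous (fun s => f2 (clamp s)) s) by (intros; now apply continuous_clamp).
assert (B1 : forall s, I01 s -> Rabs (f1 s) <= N).
{ intros s Hs.
  assert (K : f1 s = RInt (fun s => f2 (clamp s)) c s).
  { symmetry; apply is_RInt_unique.
    replace (f1 s) with (minus (C1_extension f1 f2 s) (C1_extension f1 f2 c)).
    - apply (is_RInt_derive (C1_extension f1 f2)); intros; [now apply is_derive_C1_extension | apply CC].
    - rewrite !C1_extension_eq by auto; unfold minus, plus, opp; simpl; lra. }
  rewrite K.
  eapply Rle_trans; [now apply Rabs_RInt_sub_le|].
  unfold N; apply Req_le; apply RInt_ext.
  rewrite Rmin_left, Rmax_right by lra; intros y Hy.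
  rewrite clamp_id; auto; unfold I01; lra. }
destruct (MV x Hx) as (d & Hd & Ed).
rewrite Ed, Rabs_mult.
assert (K := B1 d Hd).
unfold I01 in Hx; rewrite (Rabs_pos_eq x) by lra.
assert (0 <= Rabs (f1 d)) by apply Rabs_pos.
nra.
Qed.

(** * Odd 2-periodic extensions *)

(** Differentiation rules leave goals in abstract module operations; after unfolding, the [change]
    retypes the equality over the reals so that the algebraic tactic recognises it. *)
Ltac module_ring :=
  unfold minus, plus, opp, scal; simpl; unfold mult; simpl;
  match goal with |- @eq _ ?a ?b => change (@eq R a b) end; ring.

Ltac module_field :=
  unfold minus, plus, opp, zero, scal; simpl; unfold mult; simpl;
  match goal with |- @eq _ ?a ?b => change (@eq R a b) end; field.

Definition period_shift (s : R) : R := 2 * IZR (Int_part ((s + 1) / 2)).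

(** Distance from [s] to the nearest even integer: the map folding the line onto [0,1]. The
    derivative of an odd 2-periodic extension is the even one of the derivative, which is
    composition with this map. *)
Definition triangle_wave (s : R) : R := Rabs (s - period_shift s).

Lemma period_shift_bounds (s : R) : -1 <= s - period_shift s < 1.
Proof. unfold period_shift; destruct (base_Int_part ((s + 1) / 2)); lra. Qed.

Lemma period_shift_unique (s : R) (k : Z) :
  -1 <= s - 2 * IZR k < 1 -> period_shift s = 2 * IZR k.
Proof.
intros H; unfold period_shift; do 2 f_equal; symmetry; apply Int_part_spec; lra.
Qed.

Lemma period_shift_add (s : R) (k : Z) :
  period_shift (s + 2 * IZR k) = period_shift s + 2 * IZR k.
Proof.
replace (period_shift s + 2 * IZR k) with (2 * IZR (Int_part ((s + 1) / 2) + k)).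
- apply period_shift_unique; rewrite plus_IZR.
  assert (H := period_shift_bounds s); unfold period_shift in H; lra.
- rewrite plus_IZR; unfold period_shift; ring.
Qed.

Lemma triangle_wave_I01 (s : R) : I01 (triangle_wave s).
Proof.
assert (H := period_shift_bounds s); unfold I01, triangle_wave; split; [apply Rabs_pos|].
apply Rabs_le; lra.
Qed.

Lemma triangle_wave_le (s : R) (k : Z) : triangle_wave s <= Rabs (s - 2 * IZR k).
Proof.
assert (H := period_shift_bounds s); unfold triangle_wave.
destruct (Z.eq_dec k (Int_part ((s + 1) / 2))) as [->|n]; [unfold period_shift; lra|].
unfold period_shift in *; set (j := Int_part ((s + 1) / 2)) in *; clearbody j.
assert (D : IZR k <= IZR j - 1 \/ IZR j + 1 <= IZR k).
{ destruct (Z.lt_trichotomy k j) as [h|[h|h]]; [left | lia | right].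
  - rewrite <- minus_IZR; apply IZR_le; lia.
  - rewrite <- plus_IZR; apply IZR_le; lia. }
unfold Rabs; repeat destruct Rcase_abs; lra.
Qed.

(** A distance to a fixed set is 1-Lipschitz: the even integer nearest to one point is a competitor
    for the other. *)
Lemma triangle_wave_lipschitz (a b : R) :
  Rabs (triangle_wave a - triangle_wave b) <= Rabs (a - b).
Proof.
assert (W : forall a b, triangle_wave a <= Rabs (a - b) + triangle_wave b).
{ clear a b; intros a b.
  eapply Rle_trans; [apply (triangle_wave_le a (Int_part ((b + 1) / 2)))|].
  unfold triangle_wave, period_shift; eapply Rle_trans; [|apply Rabs_triang]; right; f_equal; ring. }
assert (A := W a b); assert (B := W b a); rewrite (Rabs_minus_sym b a) in B.
apply Rabs_le; lra.
Qed.

Lemma triangle_wave_id (s : R) : I01 s -> triangle_wave s = s.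
Proof.
unfold I01; intros H; unfold triangle_wave.
destruct (Rlt_dec s 1) as [h|h].
- rewrite (period_shift_unique s 0) by lra; rewrite Rabs_pos_eq; lra.
- rewrite (period_shift_unique s 1) by lra; rewrite Rabs_left; lra.
Qed.

Lemma triangle_wave_add (s : R) (k : Z) : triangle_wave (s + 2 * IZR k) = triangle_wave s.
Proof. unfold triangle_wave; rewrite period_shift_add; f_equal; ring. Qed.

Lemma triangle_wave_opp (s : R) : triangle_wave (- s) = triangle_wave s.
Proof.
assert (W : forall s, triangle_wave (- s) <= triangle_wave s).
{ clear s; intros s.
  eapply Rle_trans; [apply (triangle_wave_le (- s) (- Int_part ((s + 1) / 2)))|].
  rewrite opp_IZR; unfold triangle_wave, period_shift; rewrite <- Rabs_Ropp; right; f_equal; ring. }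
apply Rle_antisym; auto.
rewrite <- (Ropp_involutive s) at 1; apply W.
Qed.

Lemma Rabs_odd_periodic_le (f : R -> R) (M s : R) :
  (forall x, I01 x -> Rabs (f x) <= M) -> Rabs (odd_periodic f s) <= M.
Proof.
intros H; assert (B := period_shift_bounds s); unfold period_shift in B.
unfold odd_periodic; destruct Rle_dec.
- apply H; unfold I01; lra.
- rewrite Rabs_Ropp; apply H; unfold I01; lra.
Qed.

Lemma odd_periodic_add (f : R -> R) (s : R) (k : Z) :
  odd_periodic f (s + 2 * IZR k) = odd_periodic f s.
Proof.
assert (E := period_shift_add s k); unfold period_shift in E.
unfold odd_periodic; rewrite E.
now replace (s + 2 * IZR k - (2 * IZR (Int_part ((s + 1) / 2)) + 2 * IZR k))
  with (s - 2 * IZR (Int_part ((s + 1) / 2))) by ring.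
Qed.

Lemma odd_periodic_I01 (f : R -> R) (s : R) : f 0 = 0 -> f 1 = 0 -> I01 s ->
  odd_periodic f s = f s.
Proof.
intros f0 f1 Hs; unfold I01 in Hs; unfold odd_periodic.
change (2 * IZR (Int_part ((s + 1) / 2))) with (period_shift s).
destruct (Rlt_dec s 1) as [h|h].
- rewrite (period_shift_unique s 0) by lra.
  replace (s - 2 * 0) with s by ring; destruct Rle_dec; auto; lra.
(* The fundamental interval [-1,1) excludes 1, so [s = 1] is translated to -1 and the extension
   gives - f 1, which agrees with f 1 because f 1 = 0. *)
- rewrite (period_shift_unique s 1) by lra.
  assert (s = 1) by lra; subst s.
  destruct Rle_dec; [lra|]; replace (- (1 - 2 * 1)) with 1 by ring; rewrite f1; ring.
Qed.

Lemma odd_periodic_opp (f : R -> R) (s : R) : f 0 = 0 -> f 1 = 0 ->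
  odd_periodic f (- s) = - odd_periodic f s.
Proof.
intros f0 f1; unfold odd_periodic.
change (2 * IZR (Int_part ((s + 1) / 2))) with (period_shift s).
change (2 * IZR (Int_part ((- s + 1) / 2))) with (period_shift (- s)).
assert (B := period_shift_bounds s).
(* Negation preserves the representative interval [-1,1) except at -1, whose opposite needs one more
   translation by the period. *)
destruct (Req_dec (s - period_shift s) (-1)) as [e|n].
- assert (E : period_shift (- s) = 2 - period_shift s).
  { unfold period_shift at 2.
    replace (2 - 2 * IZR (Int_part ((s + 1) / 2)))
      with (2 * IZR (1 - Int_part ((s + 1) / 2))) by (rewrite minus_IZR; ring).
    apply period_shift_unique; rewrite minus_IZR; unfold period_shift in e; lra. }
  rewrite E; replace (- s - (2 - period_shift s)) with (-1) by lra; rewrite e.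
  destruct Rle_dec; [lra|]; replace (- (-1)) with 1 by ring; rewrite f1; ring.
- assert (E : period_shift (- s) = - period_shift s).
  { unfold period_shift at 2.
    replace (- (2 * IZR (Int_part ((s + 1) / 2))))
      with (2 * IZR (- Int_part ((s + 1) / 2))) by (rewrite opp_IZR; ring).
    apply period_shift_unique; rewrite opp_IZR; unfold period_shift in n, B; lra. }
  rewrite E; replace (- s - - period_shift s) with (- (s - period_shift s)) by ring.
  set (x := s - period_shift s) in *; clearbody x.
  repeat destruct Rle_dec; try lra.
  + replace x with 0 by lra; rewrite Ropp_0, f0; ring.
  + now rewrite Ropp_involutive.
Qed.

(** Odd reflection about an endpoint where [f] vanishes preserves the slope, so the one-sided
    derivatives agree there. Oddness and periodicity then carry the result from [0,1] to the
    line. *)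
Lemma is_derive_odd_periodic (f f1 : R -> R) (x : R) :
  (forall s, I01 s -> is_deriv_on I01 f s (f1 s)) -> f 0 = 0 -> f 1 = 0 ->
  is_derive (odd_periodic f) x (f1 (triangle_wave x)).
Proof.
intros H f0 f1'.
set (g := odd_periodic f).
assert (M : forall s, I01 s -> is_deriv_on I01 g s (f1 s)).
{ intros s Hs; apply (is_deriv_on_ext I01 f); auto.
  intros; symmetry; now apply odd_periodic_I01. }
(* [g] is odd about both endpoints of the unit interval. *)
assert (Refl : forall k s, I01 s ->
  is_deriv_on (fun y => I01 (2 * IZR k - y)) g (2 * IZR k - s) (f1 s)).
{ intros k s Hs.
  assert (Hs' : I01 (2 * IZR k - (2 * IZR k - s))).
  { now replace (2 * IZR k - (2 * IZR k - s)) with s by ring. }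
  apply (is_deriv_on_ext _ (fun y => - g (2 * IZR k - y))); auto.
  - intros y _; unfold g.
    replace (2 * IZR k - y) with (- y + 2 * IZR k) by ring.
    rewrite odd_periodic_add, odd_periodic_opp by auto; ring.
  - now apply is_deriv_on_reflect; auto. }
assert (P01 : forall s, I01 s -> is_derive g s (f1 s)).
{ intros s Hs.
  destruct (Req_dec s 0) as [e0|n0]; [|destruct (Req_dec s 1) as [e1|n1]].
  - subst s; apply (is_deriv_on_glue I01 (fun y => I01 (2 * IZR 0 - y))); try (unfold I01; lra).
    + exists (mkposreal 1 Rlt_0_1); simpl; intros y Hy.
      change (Rabs (y - 0) < 1) in Hy; apply Rabs_def2 in Hy; unfold I01; lra.
    + now apply M.
    + assert (K := Refl 0%Z 0 Hs); now replace (2 * 0 - 0) with 0 in K by ring.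
  - subst s; apply (is_deriv_on_glue I01 (fun y => I01 (2 * IZR 1 - y))); try (unfold I01; lra).
    + exists (mkposreal 1 Rlt_0_1); simpl; intros y Hy.
      change (Rabs (y - 1) < 1) in Hy; apply Rabs_def2 in Hy; unfold I01; lra.
    + now apply M.
    + assert (K := Refl 1%Z 1 Hs); now replace (2 * 1 - 1) with 1 in K by ring.
  - apply (is_deriv_on_glue I01 I01); auto.
    unfold I01 in Hs; assert (P : 0 < Rmin s (1 - s)) by (apply Rmin_pos; lra).
    exists (mkposreal _ P); intros y Hy.
    assert (A := Rmin_l s (1 - s)); assert (B := Rmin_r s (1 - s)).
    change (Rabs (y - s) < Rmin s (1 - s)) in Hy.
    apply Rabs_def2 in Hy; unfold I01; lra. }
assert (Shift : forall k (s : R), is_derive g s (f1 (triangle_wave s)) ->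
  is_derive g (s + 2 * IZR k) (f1 (triangle_wave (s + 2 * IZR k)))).
{ intros k s K; rewrite triangle_wave_add.
  apply (is_derive_ext (fun y => g (y + 2 * IZR (- k)))).
  - intros y; apply odd_periodic_add.
  - evar_last.
    + apply (is_derive_comp g (fun y => y + 2 * IZR (- k))).
      * rewrite opp_IZR; replace (s + 2 * IZR k + 2 * - IZR k) with s by ring; exact K.
      * auto_derive; auto.
    + apply Rmult_1_l. }
assert (Opp : forall s : R, is_derive g s (f1 (triangle_wave s)) ->
  is_derive g (- s) (f1 (triangle_wave (- s)))).
{ intros s K; rewrite triangle_wave_opp.
  apply (is_derive_ext (fun y => - g (- y))).
  - intros y; unfold g; rewrite odd_periodic_opp by auto; apply Ropp_involutive.
  - evar_last.
    + apply (is_derive_opp (fun y => g (- y))).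
      apply (is_derive_comp g (fun y => - y)).
      * rewrite Ropp_involutive; exact K.
      * auto_derive; auto.
    + module_ring. }
assert (B := period_shift_bounds x).
replace x with (x - period_shift x + 2 * IZR (Int_part ((x + 1) / 2)))
  by (unfold period_shift; ring).
apply Shift.
set (y := x - period_shift x) in *; clearbody y.
destruct (Rle_dec 0 y) as [hy|hy].
- rewrite triangle_wave_id by (unfold I01; lra); apply P01; unfold I01; lra.
- rewrite <- (Ropp_involutive y); apply Opp.
  rewrite triangle_wave_id by (unfold I01; lra); apply P01; unfold I01; lra.
Qed.

(** * Primitives of odd and periodic functions *)

Lemma is_derive_primitive (h : R -> R) (a x : R) :
  (forall s, continuous h s) -> is_derive (fun s => RInt h a s) x (h x).
Proof.
intros C; apply (is_derive_RInt h (fun s => RInt h a s) a); auto.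
exists (mkposreal 1 Rlt_0_1); intros y _.
exact (RInt_correct h a y (ex_RInt_of_continuous h a y C)).
Qed.

Lemma is_derive_0_const (f : R -> R) (a b : R) :
  (forall x, is_derive f x 0) -> f a = f b.
Proof.
intros H; destruct (MVT_gen f a b (fun _ => 0)) as (c & _ & E).
- intros; apply H.
- intros x _; apply continuity_pt_filterlim, (ex_derive_continuous f); eexists; apply H.
- lra.
Qed.

(** The difference of the two sides has derivative zero and vanishes at 0. *)
Lemma primitive_even (h : R -> R) (x : R) :
  (forall s, continuous h s) -> (forall s, h (- s) = - h s) ->
  RInt h 0 (- x) = RInt h 0 x.
Proof.
intros C O.
assert (E : RInt h 0 (- x) - RInt h 0 x = RInt h 0 (- 0) - RInt h 0 0).
{ apply (is_derive_0_const (fun x => RInt h 0 (- x) - RInt h 0 x)); intros s.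
  evar_last.
  - apply @is_derive_minus.
    + apply (is_derive_comp (fun s => RInt h 0 s) (fun s => - s)).
      * now apply is_derive_primitive.
      * auto_derive; auto.
    + now apply is_derive_primitive.
  - rewrite O; module_ring. }
rewrite Ropp_0 in E; lra.
Qed.

Lemma primitive_odd (h : R -> R) (x : R) :
  (forall s, continuous h s) -> (forall s, h (- s) = h s) ->
  RInt h 0 (- x) = - RInt h 0 x.
Proof.
intros C O.
assert (E : RInt h 0 (- x) + RInt h 0 x = RInt h 0 (- 0) + RInt h 0 0).
{ apply (is_derive_0_const (fun x => RInt h 0 (- x) + RInt h 0 x)); intros s.
  evar_last.
  - apply @is_derive_plus.
    + apply (is_derive_comp (fun s => RInt h 0 s) (fun s => - s)).
      * now apply is_derive_primitive.
      * auto_derive; auto.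
    + now apply is_derive_primitive.
  - rewrite O; module_ring. }
rewrite Ropp_0, RInt_point in E; unfold zero in E; simpl in E; lra.
Qed.

(** An odd function of period 2 has mean zero over a period, so its primitive from 0 is even and
    2-periodic. All its values are thus taken on [0,1], over an integration length of at most 1. *)
Lemma Rabs_primitive_odd_periodic_le (f : R -> R) (M x : R) :
  (forall s, continuous (odd_periodic f) s) -> f 0 = 0 -> f 1 = 0 ->
  (forall s, I01 s -> Rabs (f s) <= M) ->
  Rabs (RInt (odd_periodic f) 0 x) <= M.
Proof.
intros C f0 f1 HM.
set (g := odd_periodic f) in *.
assert (Even : forall s : R, RInt g 0 (- s) = RInt g 0 s).
{ intros s; apply primitive_even; auto; intros; now apply odd_periodic_opp. }
assert (Per : forall k s, RInt g 0 (s + 2 * IZR k) = RInt g 0 s).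
{ assert (D : forall k a b, RInt g 0 (a + 2 * IZR k) - RInt g 0 a
                          = RInt g 0 (b + 2 * IZR k) - RInt g 0 b).
  { intros k a b; apply (is_derive_0_const (fun s => RInt g 0 (s + 2 * IZR k) - RInt g 0 s)).
    intros s; evar_last.
    - apply @is_derive_minus.
      + apply (is_derive_comp (fun s => RInt g 0 s) (fun s => s + 2 * IZR k)).
        * now apply is_derive_primitive.
        * auto_derive; auto.
      + now apply is_derive_primitive.
    - unfold g; rewrite odd_periodic_add.
      module_ring. }
  intros k s.
  (* The increment over [k] periods does not depend on the starting point. Started at [- k] it ends
     at [k], where evenness makes it zero. *)
  assert (K := D k s (- IZR k)).
  replace (- IZR k + 2 * IZR k) with (IZR k) in K by ring.
  rewrite Even in K; lra. }
assert (B := period_shift_bounds x).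
replace x with (x - period_shift x + 2 * IZR (Int_part ((x + 1) / 2)))
  by (unfold period_shift; ring).
rewrite Per.
set (y := x - period_shift x) in *; clearbody y.
assert (M0 : 0 <= M).
{ eapply Rle_trans; [apply Rabs_pos | apply (HM 0)]; unfold I01; lra. }
assert (W : forall s, I01 s -> Rabs (RInt g 0 s) <= M).
{ unfold I01; intros s Hs.
  eapply Rle_trans.
  - apply (abs_RInt_le_const g 0 s M); [apply Hs | now apply ex_RInt_of_continuous |].
    intros; now apply Rabs_odd_periodic_le.
  - nra. }
destruct (Rle_dec 0 y) as [hy|hy].
- apply W; unfold I01; lra.
- rewrite <- Even; apply W; unfold I01; lra.
Qed.

(** * Flows made of two travelling waves *)

(** Carathéodory's form of differentiability. The factorisation is exact, so an implicit equation
    can be solved for the difference quotient by algebra, without error terms. *)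
Lemma slope_of_is_derive (f : R -> R) (x l : R) : is_derive f x l ->
  exists s : R -> R, (forall y, f y - f x = s y * (y - x)) /\ s x = l /\ continuous s x.
Proof.
intros H.
exists (fun y => if Req_EM_T y x then l else (f y - f x) / (y - x)).
repeat split.
- intros y; destruct Req_EM_T as [->|n]; [ring | field; lra].
- destruct Req_EM_T; [reflexivity | lra].
- apply filterlim_locally; intros eps.
  destruct (proj1 (is_derive_iff f x l) H (pos_div_2 eps)) as [d Hd].
  exists d; intros y Hy.
  destruct (Req_EM_T x x) as [_|n]; [|lra].
  destruct Req_EM_T as [->|n]; [apply ball_center|].
  assert (K := Hd y Hy).
  assert (P : 0 < Rabs (y - x)) by (apply Rabs_pos_lt; lra).
  change (Rabs ((f y - f x) / (y - x) - l) < eps).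
  replace ((f y - f x) / (y - x) - l) with ((f y - f x - l * (y - x)) / (y - x)) by (field; lra).
  unfold Rdiv; rewrite Rabs_mult, Rabs_inv.
  apply (Rlt_div_l _ eps); [exact P|].
  simpl in K; assert (Q := cond_pos eps); nra.
Qed.

Lemma is_derive_of_slope (f s : R -> R) (x : R) :
  locally x (fun y => f y - f x = s y * (y - x)) -> continuous s x -> is_derive f x (s x).
Proof.
intros [d1 H1] Cs; apply is_derive_iff; intros eps.
destruct (proj1 (filterlim_locally s (s x)) Cs eps) as [d2 H2].
exists (mkposreal _ (Rmin_pos _ _ (cond_pos d1) (cond_pos d2))); simpl; intros y Hy.
rewrite (H1 y) by exact (Rlt_le_trans _ _ _ Hy (Rmin_l _ _)).
replace (s y * (y - x) - s x * (y - x)) with ((s y - s x) * (y - x)) by ring.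
rewrite Rabs_mult; apply Rmult_le_compat_r; [apply Rabs_pos|].
apply Rlt_le; apply H2; exact (Rlt_le_trans _ _ _ Hy (Rmin_r _ _)).
Qed.

Lemma locally_neq_0 (h : R -> R) (x : R) :
  continuous h x -> h x <> 0 -> locally x (fun y => h y <> 0).
Proof. intros C N; apply (C (fun z => z <> 0)); now apply open_neq. Qed.

(* With slopes [SA], [SB] of [A], [B], the equation linearises exactly to
   [(1 + SA + SB) df = (e1 - k (SA - SB)) ds]. *)
Lemma is_derive_implicit (A B f : R -> R) (k m e1 e0 a1 b1 x : R) :
  is_derive A (f x + (k * x + m)) a1 -> is_derive B (f x - (k * x + m)) b1 ->
  continuous f x -> 1 + a1 + b1 <> 0 ->
  (forall s, f s + A (f s + (k * s + m)) + B (f s - (k * s + m)) = e1 * s + e0) ->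
  is_derive f x ((e1 - k * (a1 - b1)) / (1 + a1 + b1)).
Proof.
intros HA HB Cf Hn E.
destruct (slope_of_is_derive _ _ _ HA) as (SA & EA & <- & CA).
destruct (slope_of_is_derive _ _ _ HB) as (SB & EB & <- & CB).
assert (Ck : continuous (fun s => k * s + m) x).
{ apply (ex_derive_continuous (fun s => k * s + m)); auto_derive; auto. }
assert (CSA : continuous (fun s => SA (f s + (k * s + m))) x).
{ apply (continuous_comp (fun s => f s + (k * s + m)) SA); auto.
  now apply (continuous_plus f (fun s => k * s + m)). }
assert (CSB : continuous (fun s => SB (f s - (k * s + m))) x).
{ apply (continuous_comp (fun s => f s - (k * s + m)) SB); auto.
  now apply (continuous_minus f (fun s => k * s + m)). }
set (den := fun s => 1 + SA (f s + (k * s + m)) + SB (f s - (k * s + m))).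
assert (Cden : continuous den x).
{ apply (continuous_plus (fun s => 1 + SA (f s + (k * s + m)))); auto.
  apply (continuous_plus (fun _ => 1)); auto; apply continuous_const. }
apply (is_derive_of_slope f (fun s =>
  (e1 - k * (SA (f s + (k * s + m)) - SB (f s - (k * s + m)))) / den s)).
- apply (filter_imp (fun s => den s <> 0)); [|now apply locally_neq_0].
  intros s Hs; unfold Rdiv.
  apply (Rmult_eq_reg_r (den s)); auto.
  field_simplify; auto.
  assert (K := E s).
  assert (K0 := E x).
  specialize (EA (f s + (k * s + m))); specialize (EB (f s - (k * s + m))).
  unfold den; nra.
- apply (continuous_mult (fun s => e1 - k * (SA (f s + (k * s + m)) - SB (f s - (k * s + m))))
    (fun s => / den s)).
  + apply (continuous_minus (fun _ => e1)); [apply continuous_const|].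
    apply (continuous_mult (fun _ => k)); [apply continuous_const|].
    now apply (continuous_minus (fun s => SA (f s + (k * s + m)))).
  + now apply continuous_Rinv_comp.
Qed.

(** [stretch_ge] takes independent arguments: the phases z + w t and z - w t are arbitrary as t and
    z range over the line, so the bound holds for all real times and labels. *)
Record travelling_flow : Type := TravellingFlow {
  speed : R; drift : R;
  fwd : R -> R; fwd1 : R -> R; fwd2 : R -> R;
  bwd : R -> R; bwd1 : R -> R; bwd2 : R -> R;
  is_derive_fwd : forall x, is_derive fwd x (fwd1 x);
  is_derive_fwd1 : forall x, is_derive fwd1 x (fwd2 x);
  continuous_fwd2 : forall x, continuous fwd2 x;
  is_derive_bwd : forall x, is_derive bwd x (bwd1 x);
  is_derive_bwd1 : forall x, is_derive bwd1 x (bwd2 x);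
  continuous_bwd2 : forall x, continuous bwd2 x;
  stretch_ge : forall a b, 1 / 2 <= 1 + fwd1 a + bwd1 b
}.

(** * The flow, its derivatives and its inverse *)

Definition flow (K : travelling_flow) (t z : R) : R :=
  drift K * t + z + fwd K (z + speed K * t) + bwd K (z - speed K * t).

Definition flow_t (K : travelling_flow) (t z : R) : R :=
  drift K + speed K * (fwd1 K (z + speed K * t) - bwd1 K (z - speed K * t)).

Definition flow_z (K : travelling_flow) (t z : R) : R :=
  1 + fwd1 K (z + speed K * t) + bwd1 K (z - speed K * t).

Definition flow_tz (K : travelling_flow) (t z : R) : R :=
  speed K * (fwd2 K (z + speed K * t) - bwd2 K (z - speed K * t)).

Definition flow_zz (K : travelling_flow) (t z : R) : R :=
  fwd2 K (z + speed K * t) + bwd2 K (z - speed K * t).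

Definition flow_inv (K : travelling_flow) (t y : R) : R :=
  epsilon (inhabits 0) (fun z => flow K t z = y).

Lemma flow_z_pos (K : travelling_flow) (t z : R) : 0 < flow_z K t z.
Proof. assert (H := stretch_ge K (z + speed K * t) (z - speed K * t)); unfold flow_z; lra. Qed.

Lemma is_derive_comp_plus (F F1 f k : R -> R) (s df dk : R) :
  (forall x, is_derive F x (F1 x)) -> is_derive f s df -> is_derive k s dk ->
  is_derive (fun s => F (f s + k s)) s (F1 (f s + k s) * (df + dk)).
Proof.
intros HF Hf Hk; evar_last.
- apply (is_derive_comp F (fun s => f s + k s)); [apply HF|].
  apply @is_derive_plus; eauto.
- unfold scal, plus; simpl; unfold mult; simpl; apply Rmult_comm.
Qed.

Lemma is_derive_wave (F F1 E E1 f k : R -> R) (s df dk : R) :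
  (forall x, is_derive F x (F1 x)) -> (forall x, is_derive E x (E1 x)) ->
  is_derive f s df -> is_derive k s dk ->
  is_derive (fun s => F (f s + k s)) s (F1 (f s + k s) * (df + dk)) /\
  is_derive (fun s => E (f s - k s)) s (E1 (f s - k s) * (df - dk)).
Proof.
intros HF HE Hf Hk; split; [now apply is_derive_comp_plus|].
apply (is_derive_comp_plus E E1 f (fun s => - k s)); auto.
now apply (is_derive_opp k).
Qed.

Lemma is_derive_flow_z (K : travelling_flow) (t z : R) :
  is_derive (flow K t) z (flow_z K t z).
Proof.
destruct (is_derive_wave (fwd K) (fwd1 K) (bwd K) (bwd1 K)
  (fun z => z) (fun _ => speed K * t) z 1 0) as [H1 H2];
  [apply is_derive_fwd | apply is_derive_bwd | apply @is_derive_id | apply @is_derive_const |].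
evar_last.
- apply (is_derive_plus (fun z => drift K * t + z + fwd K (z + speed K * t))); [|exact H2].
  apply (is_derive_plus (fun z => drift K * t + z)); [|exact H1].
  instantiate (1 := 1); auto_derive; auto.
- unfold flow_z, plus; simpl; ring.
Qed.

Lemma is_derive_flow_t (K : travelling_flow) (t z : R) :
  is_derive (fun s => flow K s z) t (flow_t K t z).
Proof.
destruct (is_derive_wave (fwd K) (fwd1 K) (bwd K) (bwd1 K)
  (fun _ => z) (fun s => speed K * s) t 0 (speed K)) as [H1 H2];
  [apply is_derive_fwd | apply is_derive_bwd | apply @is_derive_const
  | auto_derive; auto; ring |].
evar_last.
- apply (is_derive_plus (fun s => drift K * s + z + fwd K (z + speed K * s))); [|exact H2].
  apply (is_derive_plus (fun s => drift K * s + z)); [|exact H1].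
  instantiate (1 := drift K); auto_derive; auto; ring.
- unfold flow_t, plus; simpl; ring.
Qed.

(** Injectivity, surjectivity and joint continuity of the inverse all follow from this one
    inequality, the mean value form of [stretch_ge]. *)
Lemma flow_expanding (K : travelling_flow) (t a b : R) :
  a <= b -> (b - a) / 2 <= flow K t b - flow K t a.
Proof.
intros Hab.
destruct (MVT_gen (flow K t) a b (flow_z K t)) as (c & _ & E).
- intros; apply is_derive_flow_z.
- intros x _; apply continuity_pt_filterlim, (ex_derive_continuous (flow K t)).
  eexists; apply is_derive_flow_z.
- rewrite E; assert (H := stretch_ge K (c + speed K * t) (c - speed K * t)).
  unfold flow_z; nra.
Qed.

Lemma flow_expanding_abs (K : travelling_flow) (t a b : R) :
  Rabs (b - a) <= 2 * Rabs (flow K t b - flow K t a).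
Proof.
destruct (Rle_dec a b) as [H|H].
- assert (E := flow_expanding K t a b H); rewrite !Rabs_pos_eq; lra.
- assert (E := flow_expanding K t b a ltac:(lra)); rewrite !Rabs_left; lra.
Qed.

Lemma flow_surjective (K : travelling_flow) (t y : R) : exists z, flow K t z = y.
Proof.
(* Expansion by at least 1/2 moves the flow from its value at 0 by at least |y - flow K t 0| over a
   distance [M], so the values at [- M] and [M] enclose [y]. *)
set (M := 2 * Rabs (y - flow K t 0)).
assert (M0 : 0 <= M) by (unfold M; generalize (Rabs_pos (y - flow K t 0)); lra).
assert (E1 := flow_expanding K t 0 M M0).
assert (E2 := flow_expanding K t (- M) 0 ltac:(lra)).
assert (U := Rle_abs (y - flow K t 0)).
assert (L := Rle_abs (- (y - flow K t 0))); rewrite Rabs_Ropp in L.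
fold M in U, L.
destruct (IVT_gen (flow K t) (- M) M y) as (z & _ & Hz).
- intros x; apply continuity_pt_filterlim, (ex_derive_continuous (flow K t)).
  eexists; apply is_derive_flow_z.
- unfold M in *; rewrite Rmin_left, Rmax_right by lra; lra.
- now exists z.
Qed.

Lemma flow_invK (K : travelling_flow) (t y : R) : flow K t (flow_inv K t y) = y.
Proof. exact (epsilon_spec (inhabits 0) _ (flow_surjective K t y)). Qed.

Lemma flow_inj (K : travelling_flow) (t a b : R) : flow K t a = flow K t b -> a = b.
Proof.
intros E; assert (H := flow_expanding_abs K t a b).
rewrite E, Rminus_diag, Rabs_R0 in H.
destruct (Req_dec (b - a) 0) as [|n]; [lra|].
apply Rabs_pos_lt in n; lra.
Qed.

(** Freeze the label [z] of [p]. Expansion bounds the change of label at p' = (t', y') by 2 |y' -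
    G(t', z)|, which is continuous in p' and zero at [p]. *)
Lemma continuous_flow_inv (K : travelling_flow) (p : R * R) :
  continuous (fun p => flow_inv K (fst p) (snd p)) p.
Proof.
apply filterlim_locally; intros eps.
set (z := flow_inv K (fst p) (snd p)).
assert (C : continuous (fun p' : R * R => snd p' - flow K (fst p') z) p).
{ apply (continuous_minus (snd : R * R -> R)); [apply continuous_snd|].
  apply (continuous_comp fst (fun s => flow K s z)); [apply continuous_fst|].
  apply (ex_derive_continuous (fun s => flow K s z)); eexists; apply is_derive_flow_t. }
apply (filter_imp (fun p' : R * R =>
  ball (snd p - flow K (fst p) z) (pos_div_2 eps) (snd p' - flow K (fst p') z))).
- intros p' H.
  replace (snd p - flow K (fst p) z) with 0 in H by (unfold z; rewrite flow_invK; ring).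
  change (Rabs (snd p' - flow K (fst p') z - 0) < eps / 2) in H.
  change (Rabs (flow_inv K (fst p') (snd p') - z) < eps).
  assert (B := flow_expanding_abs K (fst p') z (flow_inv K (fst p') (snd p'))).
  rewrite flow_invK in B; rewrite Rminus_0_r in H; lra.
- exact (proj1 (filterlim_locally _ _) C (pos_div_2 eps)).
Qed.

Lemma is_derive_flow_inv_t (K : travelling_flow) (t y : R) :
  is_derive (fun s => flow_inv K s y) t
    (- flow_t K t (flow_inv K t y) / flow_z K t (flow_inv K t y)).
Proof.
set (z := flow_inv K t y).
assert (P := flow_z_pos K t z).
assert (E0 : speed K * t + 0 = speed K * t) by ring.
evar_last.
(* The equation solved is Z + A(Z + w s) + B(Z - w s) = y - drift s, with a moving phase and
   right-hand slope - drift. *)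
- apply (is_derive_implicit (fwd K) (bwd K) (fun s => flow_inv K s y) (speed K) 0
    (- drift K) y (fwd1 K (z + speed K * t)) (bwd1 K (z - speed K * t))).
  + rewrite E0; apply is_derive_fwd.
  + rewrite E0; apply is_derive_bwd.
  + apply (continuous_comp_2 (fun s => s) (fun _ => y) (flow_inv K)).
    * apply continuous_id.
    * apply continuous_const.
    * apply continuous_flow_inv.
  + unfold flow_z in P; lra.
  + intros s; rewrite !Rplus_0_r.
    assert (E := flow_invK K s y); unfold flow in E; lra.
- unfold flow_t, flow_z in *; field; lra.
Qed.

Lemma is_derive_flow_inv_y (K : travelling_flow) (t y : R) :
  is_derive (flow_inv K t) y (1 / flow_z K t (flow_inv K t y)).
Proof.
set (z := flow_inv K t y).
assert (P := flow_z_pos K t z).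
assert (E0 : 0 * y + speed K * t = speed K * t) by ring.
evar_last.
(* At frozen time the phase is constant, hence [k = 0], and the right-hand side s - drift t has
   slope 1. *)
- apply (is_derive_implicit (fwd K) (bwd K) (flow_inv K t) 0 (speed K * t)
    1 (- (drift K * t)) (fwd1 K (z + speed K * t)) (bwd1 K (z - speed K * t))).
  + rewrite E0; apply is_derive_fwd.
  + rewrite E0; apply is_derive_bwd.
  + apply (continuous_comp_2 (fun _ => t) (fun s => s) (flow_inv K)).
    * apply continuous_const.
    * apply continuous_id.
    * apply continuous_flow_inv.
  + unfold flow_z in P; lra.
  + intros s; replace (0 * s + speed K * t) with (speed K * t) by ring.
    assert (E := flow_invK K t s); unfold flow in E; lra.
- unfold flow_z in *; field; lra.
Qed.

(** * Velocity and stretch as functions of time and position *)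

Lemma is_derive_velocity_t (K : travelling_flow) (t y : R) :
  let z := flow_inv K t y in
  is_derive (fun s => flow_t K s (flow_inv K s y)) t
    (speed K ^ 2 * flow_zz K t z - flow_t K t z * flow_tz K t z / flow_z K t z).
Proof.
intros z.
destruct (is_derive_wave (fwd1 K) (fwd2 K) (bwd1 K) (bwd2 K)
  (fun s => flow_inv K s y) (fun s => speed K * s) t
  (- flow_t K t z / flow_z K t z) (speed K)) as [H1 H2];
  [apply is_derive_fwd1 | apply is_derive_bwd1 | apply is_derive_flow_inv_t
  | auto_derive; auto; ring |].
evar_last.
- apply (is_derive_plus (fun _ => drift K)); [apply @is_derive_const|].
  apply (is_derive_scal (fun s => fwd1 K (flow_inv K s y + speed K * s)
                               - bwd1 K (flow_inv K s y - speed K * s))).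
  apply @is_derive_minus; [exact H1 | exact H2].
- assert (P := flow_z_pos K t z).
  unfold flow_zz, flow_tz; fold z; module_field; lra.
Qed.

Lemma is_derive_velocity_y (K : travelling_flow) (t y : R) :
  let z := flow_inv K t y in
  is_derive (fun s => flow_t K t (flow_inv K t s)) y (flow_tz K t z / flow_z K t z).
Proof.
intros z.
destruct (is_derive_wave (fwd1 K) (fwd2 K) (bwd1 K) (bwd2 K)
  (flow_inv K t) (fun _ => speed K * t) y (1 / flow_z K t z) 0) as [H1 H2];
  [apply is_derive_fwd1 | apply is_derive_bwd1 | apply is_derive_flow_inv_y
  | apply @is_derive_const |].
evar_last.
- apply (is_derive_plus (fun _ => drift K)); [apply @is_derive_const|].
  apply (is_derive_scal (fun s => fwd1 K (flow_inv K t s + speed K * t)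
                               - bwd1 K (flow_inv K t s - speed K * t))).
  apply @is_derive_minus; [exact H1 | exact H2].
- assert (P := flow_z_pos K t z).
  unfold flow_tz; fold z; module_field; lra.
Qed.

Lemma is_derive_stretch_y (K : travelling_flow) (t y : R) :
  let z := flow_inv K t y in
  is_derive (fun s => flow_z K t (flow_inv K t s)) y (flow_zz K t z / flow_z K t z).
Proof.
intros z.
destruct (is_derive_wave (fwd1 K) (fwd2 K) (bwd1 K) (bwd2 K)
  (flow_inv K t) (fun _ => speed K * t) y (1 / flow_z K t z) 0) as [H1 H2];
  [apply is_derive_fwd1 | apply is_derive_bwd1 | apply is_derive_flow_inv_y
  | apply @is_derive_const |].
evar_last.
- apply (is_derive_plus (fun s => 1 + fwd1 K (flow_inv K t s + speed K * t))); [|exact H2].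
  apply (is_derive_plus (fun _ => 1)); [apply @is_derive_const | exact H1].
- assert (P := flow_z_pos K t z).
  unfold flow_zz; fold z; module_field; lra.
Qed.

Lemma continuous_wave (K : travelling_flow) (F E : R -> R) (p : R * R) :
  (forall x, continuous F x) -> (forall x, continuous E x) ->
  continuous (fun p => F (flow_inv K (fst p) (snd p) + speed K * fst p)) p /\
  continuous (fun p => E (flow_inv K (fst p) (snd p) - speed K * fst p)) p.
Proof.
intros CF CE.
assert (Ct : continuous (fun p : R * R => speed K * fst p) p).
{ apply (continuous_scal_r (speed K) (fst : R * R -> R)); apply continuous_fst. }
split.
- apply (continuous_comp (fun p => flow_inv K (fst p) (snd p) + speed K * fst p) F); auto.
  apply (continuous_plus (fun p => flow_inv K (fst p) (snd p))); auto.
  apply continuous_flow_inv.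
- apply (continuous_comp (fun p => flow_inv K (fst p) (snd p) - speed K * fst p) E); auto.
  apply (continuous_minus (fun p => flow_inv K (fst p) (snd p))); auto.
  apply continuous_flow_inv.
Qed.

Lemma continuous_flow_derivs (K : travelling_flow) (p : R * R) :
  let at_inv (F : R -> R -> R) (p : R * R) := F (fst p) (flow_inv K (fst p) (snd p)) in
  continuous (at_inv (flow_t K)) p /\ continuous (at_inv (flow_z K)) p /\
  continuous (at_inv (flow_tz K)) p /\ continuous (at_inv (flow_zz K)) p.
Proof.
intros at_inv.
destruct (continuous_wave K (fwd1 K) (bwd1 K) p) as [C1 D1].
{ intros x; apply (ex_derive_continuous (fwd1 K)); eexists; apply is_derive_fwd1. }
{ intros x; apply (ex_derive_continuous (bwd1 K)); eexists; apply is_derive_bwd1. }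
destruct (continuous_wave K (fwd2 K) (bwd2 K) p) as [C2 D2];
  [apply continuous_fwd2 | apply continuous_bwd2 |].
set (Z := fun p : R * R => flow_inv K (fst p) (snd p)) in *.
split; [|split; [|split]].
- apply (continuous_plus (fun _ => drift K)); [apply continuous_const|].
  apply (continuous_scal_r (speed K) (fun p : R * R =>
    fwd1 K (Z p + speed K * fst p) - bwd1 K (Z p - speed K * fst p))).
  now apply (continuous_minus (fun p : R * R => fwd1 K (Z p + speed K * fst p))).
- apply (continuous_plus (fun p : R * R => 1 + fwd1 K (Z p + speed K * fst p))); auto.
  apply (continuous_plus (fun _ => 1)); [apply continuous_const | auto].
- apply (continuous_scal_r (speed K) (fun p : R * R =>
    fwd2 K (Z p + speed K * fst p) - bwd2 K (Z p - speed K * fst p))).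
  now apply (continuous_minus (fun p : R * R => fwd2 K (Z p + speed K * fst p))).
- now apply (continuous_plus (fun p : R * R => fwd2 K (Z p + speed K * fst p))).
Qed.

(** An interior point has a neighbourhood on which [f] and [fs] coincide, so [g] is the derivative
    there. At other points [g] is also the required witness, and its continuity supplies the
    limit. *)
Lemma is_d_dt_of_global (D : R * R -> Prop) (f fs : R -> R -> R) (g : R * R -> R) (t y : R) :
  (forall t y, D (t, y) -> f t y = fs t y) ->
  (forall t y, is_derive (fun s => fs s y) t (g (t, y))) ->
  continuous g (t, y) -> is_d_dt D f t y (g (t, y)).
Proof.
intros E H C.
assert (I : forall p, int_of D p -> is_derive (fun s => f s (snd p)) (fst p) (g p)).
{ intros [t' y'] [d Hd]; simpl.
  apply (is_derive_ext_loc (fun s => fs s y')); [|apply H].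
  exists d; intros s Hs; symmetry; apply E, Hd.
  split; [exact Hs | apply ball_center]. }
split; [apply I|].
intros _; exists g; split.
- unfold within; apply filter_forall; exact I.
- intros P HP; change (locally (t, y) (fun p => int_of D p -> P (g p))).
  apply (filter_imp (fun p => P (g p))); [auto | exact (C P HP)].
Qed.

Lemma is_d_dy_of_global (D : R * R -> Prop) (f fs : R -> R -> R) (g : R * R -> R) (t y : R) :
  (forall t y, D (t, y) -> f t y = fs t y) ->
  (forall t y, is_derive (fs t) y (g (t, y))) ->
  continuous g (t, y) -> is_d_dy D f t y (g (t, y)).
Proof.
intros E H C.
assert (I : forall p, int_of D p -> is_derive (fun s => f (fst p) s) (snd p) (g p)).
{ intros [t' y'] [d Hd]; simpl.
  apply (is_derive_ext_loc (fs t')); [|apply H].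
  exists d; intros s Hs; symmetry; apply E, Hd.
  split; [apply ball_center | exact Hs]. }
split; [apply I|].
intros _; exists g; split.
- unfold within; apply filter_forall; exact I.
- intros P HP; change (locally (t, y) (fun p => int_of D p -> P (g p))).
  apply (filter_imp (fun p => P (g p))); [auto | exact (C P HP)].
Qed.

(** Accumulation of interior points makes the relative filter proper, hence its limits unique. This
    pins down the density, which is chosen by [epsilon]. *)
Lemma is_d_dy_unique (D : R * R -> Prop) (f : R -> R -> R) (t y l1 l2 : R) :
  (forall P : R * R -> Prop, locally (t, y) P -> exists p, P p /\ int_of D p) ->
  is_d_dy D f t y l1 -> is_d_dy D f t y l2 -> l1 = l2.
Proof.
intros Acc [I1 B1] [I2 B2].
destruct (excluded_middle_informative (int_of D (t, y))) as [I|N].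
- rewrite <- (is_derive_unique _ _ _ (I1 I)); exact (is_derive_unique _ _ _ (I2 I)).
- destruct (B1 N) as (g1 & H1 & L1), (B2 N) as (g2 & H2 & L2).
  set (F := within (int_of D) (locally (t, y))) in *.
  assert (PF : ProperFilter' F).
  { split; [|apply within_filter; apply locally_filter].
    intros Hf; destruct (Acc _ Hf) as (p & Hp & Ip); exact (Hp Ip). }
  apply (filterlim_locally_unique (F := F) g1); auto.
  apply (filterlim_ext_loc g2); auto.
  apply (filter_imp (fun p => is_derive (fun s => f (fst p) s) (snd p) (g1 p) /\
                              is_derive (fun s => f (fst p) s) (snd p) (g2 p))).
  + intros p [K1 K2]; rewrite <- (is_derive_unique _ _ _ K1); symmetry.
    exact (is_derive_unique _ _ _ K2).
  + now apply filter_and.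
Qed.

Lemma flow_strip_int (K : travelling_flow) (D : R * R -> Prop) (t y : R) :
  (forall p, 0 <= fst p -> flow K (fst p) 0 <= snd p <= flow K (fst p) 1 -> D p) ->
  0 < t -> flow K t 0 < y < flow K t 1 -> int_of D (t, y).
Proof.
intros HD Ht Hy.
assert (C : forall z, continuous (fun p : R * R => snd p - flow K (fst p) z) (t, y)).
{ intros z; apply (continuous_minus (snd : R * R -> R)); [apply continuous_snd|].
  apply (continuous_comp fst (fun s => flow K s z)); [apply continuous_fst|].
  apply (ex_derive_continuous (fun s => flow K s z)); eexists; apply is_derive_flow_t. }
unfold int_of; apply (filter_imp (fun p : R * R => 0 < fst p /\
   (0 < snd p - flow K (fst p) 0 /\ snd p - flow K (fst p) 1 < 0))).
- intros p (H1 & H2 & H3); apply HD; lra.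
- apply filter_and; [|apply filter_and].
  + assert (Cf : continuous (fst : R * R -> R) (t, y)) by apply continuous_fst.
    apply (Cf (fun s => 0 < s)); now apply open_gt.
  + apply (C 0 (fun s => 0 < s)); apply open_gt; simpl; lra.
  + apply (C 1 (fun s => s < 0)); apply open_lt; simpl; lra.
Qed.

(* Moving [(t, y) = (t, flow t z)] along [e |-> (t + e, flow (t + e) (z + e (1/2 - z)))]
   enters the interior at once. *)
Lemma flow_strip_accumulation (K : travelling_flow) (D : R * R -> Prop) (t y : R) :
  (forall p, 0 <= fst p -> flow K (fst p) 0 <= snd p <= flow K (fst p) 1 -> D p) ->
  0 <= t -> flow K t 0 <= y <= flow K t 1 ->
  forall P : R * R -> Prop, locally (t, y) P -> exists p, P p /\ int_of D p.
Proof.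
intros HD Ht Hy P HP.
set (z := flow_inv K t y).
assert (Ez : flow K t z = y) by apply flow_invK.
assert (Hz : 0 <= z <= 1).
{ split; apply Rnot_lt_le; intros h.
  - assert (E := flow_expanding K t z 0 ltac:(lra)); lra.
  - assert (E := flow_expanding K t 1 z ltac:(lra)); lra. }
set (zeta e := z + e * (1 / 2 - z)).
assert (Czeta : forall e, continuous zeta e).
{ intros e; apply (ex_derive_continuous zeta); unfold zeta; auto_derive; auto. }
assert (Ct : continuous (fun e => t + e) 0).
{ apply (ex_derive_continuous (fun e => t + e)); auto_derive; auto. }
assert (C : continuous (fun e => (t + e, flow K (t + e) (zeta e))) 0).
{ apply (continuous_comp_2 (fun e => t + e) (fun e => flow K (t + e) (zeta e)) (fun a b => (a, b)));
    [exact Ct | | ].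
  - unfold flow.
    apply (continuous_plus (fun e => drift K * (t + e) + zeta e + fwd K (zeta e + speed K * (t + e)))).
    + apply (continuous_plus (fun e => drift K * (t + e) + zeta e)).
      * apply (ex_derive_continuous (fun e => drift K * (t + e) + zeta e)).
        unfold zeta; auto_derive; auto.
      * apply (continuous_comp (fun e => zeta e + speed K * (t + e)) (fwd K)).
        -- apply (ex_derive_continuous (fun e => zeta e + speed K * (t + e))).
           unfold zeta; auto_derive; auto.
        -- apply (ex_derive_continuous (fwd K)); eexists; apply is_derive_fwd.
    + apply (continuous_comp (fun e => zeta e - speed K * (t + e)) (bwd K)).
      * apply (ex_derive_continuous (fun e => zeta e - speed K * (t + e))).
        unfold zeta; auto_derive; auto.
      * apply (ex_derive_continuous (bwd K)); eexists; apply is_derive_bwd.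
  - apply (continuous_ext (fun p : R * R => p)); [now intros []|]; apply continuous_id. }
assert (Q : locally 0 (fun e => P (t + e, flow K (t + e) (zeta e)))).
{ apply C; replace (t + 0) with t by ring; replace (zeta 0) with z by (unfold zeta; ring).
  now rewrite Ez. }
destruct Q as [d Hd].
(* Below [d] the moved point stays in [P]; positive and at most 1, [e] makes the time positive and
   the label a convex combination of [z] and 1/2 lying strictly inside (0,1). *)
set (e := Rmin (d / 2) 1).
assert (He : 0 < e <= 1 /\ e < d).
{ assert (A := cond_pos d); unfold e, Rmin; destruct Rle_dec; lra. }
exists (t + e, flow K (t + e) (zeta e)); split.
- apply Hd; change (Rabs (e - 0) < d); rewrite Rminus_0_r, Rabs_pos_eq; lra.
- apply (flow_strip_int K); auto; [lra|].
  assert (Hi : 0 < zeta e < 1) by (unfold zeta; split; nra).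
  assert (E1 := flow_expanding K (t + e) 0 (zeta e) ltac:(lra)).
  assert (E2 := flow_expanding K (t + e) (zeta e) 1 ltac:(lra)).
  lra.
Qed.

(** * Reduction of the continuum flow to travelling waves *)

Lemma C_on_is_deriv_on (n : nat) (D : R -> Prop) (f : R -> R) (x : R) :
  C_on (S n) D f -> D x -> is_deriv_on D f x (deriv_on D f x).
Proof. intros [H _] Dx; apply deriv_on_spec; auto. Qed.

Lemma C_on_continuous_on (n : nat) (D : R -> Prop) (f : R -> R) :
  C_on n D f -> continuous_on D f.
Proof.
destruct n; [auto|]; intros H.
apply (is_deriv_on_continuous_on D f (deriv_on D f)).
intros; now apply (C_on_is_deriv_on n).
Qed.

Lemma inverse_on_spec (a b : R) (f : R -> R) (y : R) :
  (exists x, a <= x <= b /\ f x = y) ->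
  a <= inverse_on a b f y <= b /\ f (inverse_on a b f y) = y.
Proof. intros H; exact (epsilon_spec (inhabits 0) _ H). Qed.

Lemma deriv_on_nonneg_eq (f : R -> R) (t l : R) :
  0 <= t -> is_derive f t l -> deriv_on (Rle 0) f t = l.
Proof.
intros Ht H; apply deriv_on_eq; auto; [|now apply is_derive_deriv_on].
intros d; assert (P := cond_pos d); exists (t + d / 2); repeat split; try lra.
rewrite Rabs_pos_eq; lra.
Qed.

Lemma deriv_on_I01_0_eq (f : R -> R) (l : R) :
  is_derive f 0 l -> deriv_on I01 f 0 = l.
Proof.
assert (I0 : I01 0) by (unfold I01; lra).
intros H; apply deriv_on_eq; auto; [|now apply is_derive_deriv_on].
intros d; assert (P := cond_pos d); exists (Rmin (d / 2) 1).
unfold I01, Rmin; destruct Rle_dec; rewrite Rabs_pos_eq; lra.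
Qed.

(** Replacing [X] by its clamped version leaves the mass unchanged on [0,1] and gives an integrand
    continuous and positive on the line, so the mass is differentiable and strictly increasing
    everywhere. *)
Lemma mass_clamp (X : R -> R) : continuous_on I01 X ->
  (forall x, 0 <= x <= 1 -> 0 < X x) ->
  (forall z, I01 z -> RInt X 0 z = RInt (fun s => X (clamp s)) 0 z) /\
  (forall z, is_derive (fun z => RInt (fun s => X (clamp s)) 0 z) z (X (clamp z))) /\
  (forall a b, a < b ->
    RInt (fun s => X (clamp s)) 0 a < RInt (fun s => X (clamp s)) 0 b).
Proof.
intros CX HX.
assert (C : forall s, continuous (fun s => X (clamp s)) s) by (intros; now apply continuous_clamp).
assert (D : forall z, is_derive (fun z => RInt (fun s => X (clamp s)) 0 z) z (X (clamp z))).
{ intros z; now apply (is_derive_primitive (fun s => X (clamp s))). }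
split; [|split; [exact D|]].
- intros z Hz; apply RInt_ext; unfold I01 in Hz.
  rewrite Rmin_left, Rmax_right by lra; intros s Hs; rewrite clamp_id; auto; unfold I01; lra.
- intros a b Hab.
  destruct (MVT_gen (fun z => RInt (fun s => X (clamp s)) 0 z) a b (fun z => X (clamp z)))
    as (c & _ & E); [intros; apply D | |].
  + intros x _; apply continuity_pt_filterlim.
    apply (ex_derive_continuous (fun z => RInt (fun s => X (clamp s)) 0 z)); eexists; apply D.
  + assert (P := HX _ (clamp_I01 c)); nra.
Qed.

Lemma zeta_spec (X : R -> R) (x : R) : continuous_on I01 X ->
  (forall x, 0 <= x <= 1 -> 0 < X x) ->
  0 <= x <= length_L X -> I01 (zeta X x) /\ RInt X 0 (zeta X x) = x.
Proof.
intros CX HX Hx; apply inverse_on_spec.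
destruct (mass_clamp X CX HX) as (E & D & M).
unfold length_L in Hx; rewrite E in Hx by (unfold I01; lra).
destruct (IVT_gen (fun z => RInt (fun s => X (clamp s)) 0 z) 0 1 x) as (z & Hz & Ez).
- intros z; apply continuity_pt_filterlim.
  apply (ex_derive_continuous (fun z => RInt (fun s => X (clamp s)) 0 z)); eexists; apply D.
- rewrite RInt_point; unfold zero; simpl; rewrite Rmin_left, Rmax_right; lra.
- rewrite Rmin_left, Rmax_right in Hz by lra.
  exists z; split; auto; rewrite E; auto.
Qed.

Lemma mass_bounds (X : R -> R) (z : R) : continuous_on I01 X ->
  (forall x, 0 <= x <= 1 -> 0 < X x) ->
  I01 z -> 0 <= RInt X 0 z <= length_L X.
Proof.
intros CX HX Hz.
destruct (mass_clamp X CX HX) as (E & D & M).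
assert (W : forall a b, I01 a -> I01 b -> a <= b -> RInt X 0 a <= RInt X 0 b).
{ intros a b Ha Hb [h|<-]; [|lra]; rewrite !E by auto; apply Rlt_le; auto. }
assert (E0 : RInt X 0 0 = 0) by apply (RInt_point 0 X).
unfold length_L; rewrite <- E0 at 1; unfold I01 in *; split; apply W; lra.
Qed.

Lemma zeta_mass (X : R -> R) (z : R) : continuous_on I01 X ->
  (forall x, 0 <= x <= 1 -> 0 < X x) ->
  I01 z -> zeta X (RInt X 0 z) = z.
Proof.
intros CX HX Hz.
destruct (zeta_spec X (RInt X 0 z) CX HX) as [H1 H2]; [now apply mass_bounds|].
destruct (mass_clamp X CX HX) as (E & D & M).
set (z' := zeta X _) in *; clearbody z'.
rewrite !E in H2 by auto.
destruct (Rtotal_order z' z) as [h|[h|h]]; auto; apply M in h; lra.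
Qed.

(* The antiderivative in [z] of d'Alembert's formula contributes at [z = 0]
   exactly the opposite of the double time integral defining [G(t,0)]. *)
Lemma posG_travelling (w v : R) (X V : R -> R) : 0 < w ->
  C_on 4 I01 X -> C_on 4 I01 V -> X 0 = 1 -> X 1 = 1 -> V 0 = 0 -> V 1 = 0 ->
  gamma_XV w X V <= 1 / 2 ->
  exists K : travelling_flow, speed K = w /\
    forall t z, posG w v X V t z = flow K t z.
Proof.
intros hw hX hV hX0 hX1 hV0 hV1 hg.
set (fX := fun s => X s - 1).
set (phi := odd_periodic fX).
set (psi := odd_periodic V).
assert (IX : forall s, I01 s -> is_deriv_on I01 X s (deriv_on I01 X s)).
{ intros; now apply (C_on_is_deriv_on 3). }
assert (IV : forall s, I01 s -> is_deriv_on I01 V s (deriv_on I01 V s)).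
{ intros; now apply (C_on_is_deriv_on 3). }
assert (IfX : forall s, I01 s -> is_deriv_on I01 fX s (deriv_on I01 X s)).
{ intros s Hs; apply is_deriv_on_iff; auto; intros eps.
  destruct (proj1 (is_deriv_on_iff _ _ _ _ Hs) (IX s Hs) eps) as [d Hd]; exists d.
  intros y Dy Hy; unfold fX.
  replace (X y - 1 - (X s - 1)) with (X y - X s) by ring; auto. }
assert (fX0 : fX 0 = 0) by (unfold fX; lra).
assert (fX1 : fX 1 = 0) by (unfold fX; lra).
set (phi1 := fun s => deriv_on I01 X (triangle_wave s)).
assert (Dphi : forall s, is_derive phi s (phi1 s)).
{ intros s; now apply is_derive_odd_periodic. }
assert (Cphi1 : forall s, continuous phi1 s).
{ intros s; apply (continuous_on_comp_lipschitz I01 (deriv_on I01 X) triangle_wave).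
  - apply triangle_wave_I01.
  - apply triangle_wave_lipschitz.
  - apply (C_on_continuous_on 3), hX. }
assert (Cphi : forall s, continuous phi s).
{ intros s; apply (ex_derive_continuous phi); eexists; apply Dphi. }
assert (Cpsi : forall s, continuous psi s).
{ intros s; apply (ex_derive_continuous psi); eexists.
  now apply (is_derive_odd_periodic V (deriv_on I01 V)). }
assert (Ophi : forall s, phi (- s) = - phi s) by (intros; now apply odd_periodic_opp).
assert (Opsi : forall s, psi (- s) = - psi s) by (intros; now apply odd_periodic_opp).
assert (Ephi1 : forall s, phi1 (- s) = phi1 s).
{ intros; unfold phi1; now rewrite triangle_wave_opp. }
set (Phi := fun x => RInt phi 0 x).
set (Psi1 := fun x => RInt psi 0 x).
assert (DPhi : forall s, is_derive Phi s (phi s)) by (intros; now apply is_derive_primitive).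
assert (DPsi1 : forall s, is_derive Psi1 s (psi s)) by (intros; now apply is_derive_primitive).
assert (CPsi1 : forall s, continuous Psi1 s).
{ intros s; apply (ex_derive_continuous Psi1); eexists; apply DPsi1. }
set (Psi2 := fun x => RInt Psi1 0 x).
assert (DPsi2 : forall s, is_derive Psi2 s (Psi1 s)) by (intros; now apply is_derive_primitive).
assert (EPhi : forall s, Phi (- s) = Phi s) by (intros; now apply primitive_even).
assert (EPsi1 : forall s, Psi1 (- s) = Psi1 s) by (intros; now apply primitive_even).
assert (OPsi2 : forall s, Psi2 (- s) = - Psi2 s) by (intros; now apply primitive_odd).
assert (Phi0 : Phi 0 = 0) by apply (RInt_point 0 phi).
assert (Psi10 : Psi1 0 = 0) by apply (RInt_point 0 psi).
assert (Psi20 : Psi2 0 = 0) by apply (RInt_point 0 Psi1).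
assert (phi0 : phi 0 = 0).
{ assert (E := Ophi 0); rewrite Ropp_0 in E; lra. }
assert (Bphi : forall s, Rabs (phi s) <= alpha_X X).
{ intros s; apply Rabs_odd_periodic_le; intros x Hx.
  unfold fX; rewrite <- hX0.
  apply (Rabs_le_RInt_second_deriv X (deriv_on I01 X)); auto; [| |lra].
  - intros; apply (C_on_is_deriv_on 2); auto; apply hX.
  - apply (C_on_continuous_on 2), hX. }
assert (BPsi1 : forall s, Rabs (Psi1 s) <= beta_V V).
{ intros s; apply Rabs_primitive_odd_periodic_le; auto; intros x Hx.
  replace (V x) with (V x - V 0) by (rewrite hV0; ring).
  apply (Rabs_le_RInt_second_deriv V (deriv_on I01 V)); auto; [| |lra].
  - intros; apply (C_on_is_deriv_on 2); auto; apply hV.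
  - apply (C_on_continuous_on 2), hV. }
assert (Lin : forall (f g : R -> R) a b x df dg, is_derive f x df -> is_derive g x dg ->
  is_derive (fun x => f x * a + g x * b) x (df * a + dg * b)).
{ intros f g a b x df dg Hf Hg; apply @is_derive_plus.
  - now apply (is_derive_scal_l (V := R_NormedModule) f).
  - now apply (is_derive_scal_l (V := R_NormedModule) g). }
set (c := / (2 * w)).
(* [A1] and [B1] are the right- and left-hand halves of d'Alembert's formula, with its velocity
   integral split at 0; [A] and [B] are their antiderivatives. *)
set (A := fun x => Phi x * (1 / 2) + Psi2 x * c).
set (A1 := fun x => phi x * (1 / 2) + Psi1 x * c).
set (A2 := fun x => phi1 x * (1 / 2) + psi x * c).
set (B := fun x => Phi x * (1 / 2) + Psi2 x * - c).
set (B1 := fun x => phi x * (1 / 2) + Psi1 x * - c).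
set (B2 := fun x => phi1 x * (1 / 2) + psi x * - c).
assert (DA : forall x, is_derive A x (A1 x)) by (intros; now apply Lin).
assert (DA1 : forall x, is_derive A1 x (A2 x)) by (intros; now apply Lin).
assert (DB : forall x, is_derive B x (B1 x)) by (intros; now apply Lin).
assert (DB1 : forall x, is_derive B1 x (B2 x)) by (intros; now apply Lin).
assert (C2 : forall a x, continuous (fun x => phi1 x * (1 / 2) + psi x * a) x).
{ intros a x; apply (continuous_plus (fun x => phi1 x * (1 / 2)) (fun x => psi x * a)).
  - now apply (continuous_mult phi1 (fun _ => 1 / 2)); [|apply continuous_const].
  - now apply (continuous_mult psi (fun _ => a)); [|apply continuous_const]. }
assert (Hc : 0 < c) by (apply Rinv_0_lt_compat; lra).
assert (Hst : forall a b, 1 / 2 <= 1 + A1 a + B1 b).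
(* The halves of [phi] contribute at least - alpha and the two [Psi1] terms at least - 2 beta c = -
   beta/w, so the sum is at least 1 - alpha - beta/w, which is at least 1 - gamma. *)
{ intros a b; unfold A1, B1.
  assert (H1 := Bphi a); assert (H2 := Bphi b); assert (H3 := BPsi1 a); assert (H4 := BPsi1 b).
  apply Rabs_le_between in H1, H2, H3, H4.
  unfold gamma_XV in hg.
  assert (Eb : beta_V V / w = 2 * (beta_V V * c)) by (unfold c; field; lra).
  assert (Ha : 0 <= alpha_X X) by (generalize (Rabs_pos (phi 0)), (Bphi 0); lra).
  assert (- beta_V V * c <= Psi1 a * c) by (apply Rmult_le_compat_r; lra).
  assert (Psi1 b * c <= beta_V V * c) by (apply Rmult_le_compat_r; lra).
  lra. }
exists (TravellingFlow w v A A1 A2 B B1 B2 DA DA1 (C2 c) DB DB1 (C2 (- c)) Hst).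
split; [reflexivity|].
assert (Eq : forall t x, qsol w X V t x = A1 (x + w * t) + B1 (x - w * t)).
{ intros t x; unfold qsol; fold fX; fold phi; fold psi.
  replace (RInt psi (x - w * t) (x + w * t)) with (Psi1 (x + w * t) - Psi1 (x - w * t)).
  - unfold A1, B1, c; field; lra.
  - unfold Psi1.
    rewrite <- (RInt_Chasles psi 0 (x - w * t) (x + w * t)) by now apply ex_RInt_of_continuous.
    unfold plus; simpl; ring. }
(* At the wall the two waves meet at opposite arguments: [phi1] is even and [psi] odd, so their
   contributions add. *)
assert (Dq : forall t, deriv_on I01 (qsol w X V t) 0 = phi1 (w * t) + psi (w * t) / w).
{ intros t; apply deriv_on_I01_0_eq.
  apply (is_derive_ext (fun x => A1 (x + w * t) + B1 (x - w * t))); [now intros; rewrite Eq|].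
  destruct (is_derive_wave A1 A2 B1 B2 (fun x => x) (fun _ => w * t) 0 1 0) as [H1 H2]; auto;
    [apply @is_derive_id | apply @is_derive_const |].
  evar_last; [apply @is_derive_plus; [exact H1 | exact H2] |].
  unfold A2, B2, plus; simpl.
  replace (0 + w * t) with (w * t) by ring; replace (0 - w * t) with (- (w * t)) by ring.
  rewrite Ephi1, Opsi; unfold c; field; lra. }
intros t z; unfold posG, flow; simpl.
assert (EI : RInt (qsol w X V t) 0 z
  = A (z + w * t) + B (z - w * t) - (A (0 + w * t) + B (0 - w * t))).
{ apply is_RInt_unique.
  apply (is_RInt_ext (fun x => A1 (x + w * t) + B1 (x - w * t))); [now intros; rewrite Eq|].
  apply (is_RInt_derive (fun x => A (x + w * t) + B (x - w * t))).
  - intros x _.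
    destruct (is_derive_wave A A1 B B1 (fun x => x) (fun _ => w * t) x 1 0) as [H1 H2]; auto;
      [apply @is_derive_id | apply @is_derive_const |].
    evar_last; [apply @is_derive_plus; [exact H1 | exact H2] |].
    unfold plus; simpl; ring.
  - intros x _.
    apply (ex_derive_continuous (fun x => A1 (x + w * t) + B1 (x - w * t))).
    destruct (is_derive_wave A1 A2 B1 B2 (fun x => x) (fun _ => w * t) x 1 0) as [H1 H2]; auto;
      [apply @is_derive_id | apply @is_derive_const |].
    eexists; apply @is_derive_plus; [exact H1 | exact H2]. }
assert (EG : w ^ 2 * RInt (fun s => (t - s) * deriv_on I01 (qsol w X V s) 0) 0 t
  = Phi (w * t) + Psi2 (w * t) / w).
(* Integration by parts: t - s times a primitive of q_x(s,0), plus a primitive of that primitive. At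
   s = t only the last part remains, and at s = 0 everything vanishes. *)
{ set (H := fun s => (t - s) * (phi (w * s) / w + Psi1 (w * s) / w ^ 2)
                     + (Phi (w * s) / w ^ 2 + Psi2 (w * s) / w ^ 3)).
  replace (RInt _ 0 t) with (H t - H 0).
  - unfold H; replace (w * 0) with 0 by ring.
    rewrite Phi0, Psi10, Psi20, phi0; field; lra.
  - symmetry; apply is_RInt_unique.
    apply (is_RInt_ext (fun s => (t - s) * (phi1 (w * s) + psi (w * s) / w)));
      [now intros; rewrite Dq|].
    apply (is_RInt_derive H).
    + intros s _; unfold H.
      assert (S : forall (F : R -> R) l, is_derive F (w * s) l ->
                    is_derive (fun s => F (w * s)) s (w * l)).
      { intros F l HF; apply (is_derive_comp F (fun s => w * s)); auto.
        auto_derive; auto; ring. }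
      evar_last.
      * apply @is_derive_plus.
        -- apply (is_derive_mult (fun s => t - s)
             (fun s => phi (w * s) / w + Psi1 (w * s) / w ^ 2)).
           ++ instantiate (1 := -1); auto_derive; auto; ring.
           ++ apply (Lin (fun s => phi (w * s)) (fun s => Psi1 (w * s)));
                apply S; [apply Dphi | apply DPsi1].
           ++ intros; apply Rmult_comm.
        -- apply (Lin (fun s => Phi (w * s)) (fun s => Psi2 (w * s)));
             apply S; [apply DPhi | apply DPsi2].
      * module_field; lra.
    + intros s _.
      assert (Cw : continuous (fun s => w * s) s).
      { apply (ex_derive_continuous (fun s => w * s)); auto_derive; auto. }
      apply (continuous_mult (fun s => t - s) (fun s => phi1 (w * s) + psi (w * s) / w)).
      * apply (ex_derive_continuous (fun s => t - s)); auto_derive; auto.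
      * apply (continuous_plus (fun s => phi1 (w * s))).
        -- now apply (continuous_comp (fun s => w * s) phi1).
        -- apply (continuous_mult (fun s => psi (w * s)) (fun _ => / w)); [|apply continuous_const].
           now apply (continuous_comp (fun s => w * s) psi). }
unfold posG0; rewrite EG, EI.
replace (0 + w * t) with (w * t) by ring; replace (0 - w * t) with (- (w * t)) by ring.
unfold A at 2; unfold B at 2; rewrite EPhi, OPsi2.
unfold c; field; lra.
Qed.

(** * The space-time domain and the label in terms of the flow *)

Lemma traj_range (w v : R) (X V : R -> R) (K : travelling_flow) (t y : R) :
  continuous_on I01 X -> (forall x, 0 <= x <= 1 -> 0 < X x) ->
  (forall t z, posG w v X V t z = flow K t z) ->
  (Y0 w v X V t <= y <= YL w v X V t <-> flow K t 0 <= y <= flow K t 1).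
Proof.
intros CX HX EG.
assert (E0 : Y0 w v X V t = flow K t 0).
{ unfold Y0, traj; rewrite EG; f_equal.
  rewrite <- (zeta_mass X 0) at 2; auto; [|unfold I01; lra].
  f_equal; symmetry; apply (RInt_point 0 X). }
assert (E1 : YL w v X V t = flow K t 1).
{ unfold YL, traj; rewrite EG; f_equal; apply zeta_mass; auto; unfold I01; lra. }
now rewrite E0, E1.
Qed.

(** Both inverses inside [labelF] are epsilon choices. It suffices that some particle reaches [y],
    namely the one whose mass coordinate is the mass up to label [z]; injectivity of the flow then
    identifies the label. *)
Lemma labelF_eq (w v : R) (X V : R -> R) (K : travelling_flow) (t y : R) :
  continuous_on I01 X -> (forall x, 0 <= x <= 1 -> 0 < X x) ->
  (forall t z, posG w v X V t z = flow K t z) ->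
  flow K t 0 <= y <= flow K t 1 -> labelF w v X V t y = flow_inv K t y.
Proof.
intros CX HX EG Hy.
apply (flow_inj K t); rewrite flow_invK, <- EG.
apply (inverse_on_spec 0 (length_L X) (traj w v X V t) y).
set (z := flow_inv K t y).
assert (Ez : flow K t z = y) by apply flow_invK.
assert (Hz : I01 z).
{ split; apply Rnot_lt_le; intros h.
  - assert (E := flow_expanding K t z 0 ltac:(lra)); lra.
  - assert (E := flow_expanding K t 1 z ltac:(lra)); lra. }
exists (RInt X 0 z); split; [now apply mass_bounds|].
unfold traj; now rewrite EG, zeta_mass.
Qed.

Theorem theorem4 (r w v : R) (X V : R -> R)
  (hr : 0 < r < 1) (hw : 0 < w)
  (hX : C_on 4 I01 X) (hV : C_on 4 I01 V)
  (hXpos : forall x, 0 <= x <= 1 -> 0 < X x)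
  (hX0 : X 0 = 1) (hX1 : X 1 = 1) (hV0 : V 0 = 0) (hV1 : V 1 = 0)
  (hgamma : gamma_XV w X V < Rmin r ((1 - r) / 2))
  (C t y : R) (ht : 0 <= t)
  (hy : Y0 w v X V t <= y <= YL w v X V t) :
  let D := spacetime w v X V in
  let u := velocity w v X V in
  let rho := density w v X V in
  let p := pressure w v X V C in
  is_d_dy D (labelF w v X V) t y (rho t y) /\ rho t y <> 0 /\
  exists u_t u_y invrho_y p_y : R,
    is_d_dt D u t y u_t /\
    is_d_dy D u t y u_y /\
    is_d_dy D (fun t' y' => 1 / rho t' y') t y invrho_y /\
    is_d_dy D p t y p_y /\
    u_t + u t y * u_y = w ^ 2 * (1 / rho t y) * invrho_y /\
    w ^ 2 * (1 / rho t y) * invrho_y = - (1 / rho t y) * p_y.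
Proof.
intros D u rho p.
assert (CX : continuous_on I01 X) by now apply (C_on_continuous_on 4).
destruct (posG_travelling w v X V) as (K & EK & EG); auto.
(* Since r > 0, the bound (1 - r)/2 lies below 1/2. *)
{ assert (B := Rmin_r r ((1 - r) / 2)); lra. }
assert (HD : forall t y, D (t, y) <-> 0 <= t /\ flow K t 0 <= y <= flow K t 1).
{ intros t' y'; rewrite <- (traj_range w v X V K t' y' CX hXpos EG); reflexivity. }
assert (HD' : forall q, 0 <= fst q -> flow K (fst q) 0 <= snd q <= flow K (fst q) 1 -> D q).
{ intros [t' y'] H1 H2; now apply HD. }
set (Z := flow_inv K).
assert (EF : forall t y, D (t, y) -> labelF w v X V t y = Z t y).
{ intros t' y' H; apply HD in H; now apply labelF_eq. }
(* The particle stays fixed while time varies, so this is a time derivative at a frozen label. The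
   flow is differentiable at all real times, which includes the one-sided derivative at t = 0. *)
assert (Eu : forall t y, D (t, y) -> u t y = flow_t K t (Z t y)).
{ intros t' y' H; rewrite <- (EF _ _ H); apply deriv_on_nonneg_eq; [now apply HD in H|].
  apply (is_derive_ext (fun s => flow K s (labelF w v X V t' y'))).
  - intros s; symmetry; apply EG.
  - apply is_derive_flow_t. }
assert (Cinv : forall q, continuous (fun q => / flow_z K (fst q) (Z (fst q) (snd q))) q).
{ intros q; destruct (continuous_flow_derivs K q) as (_ & C1 & _ & _).
  apply (continuous_comp (fun q => flow_z K (fst q) (Z (fst q) (snd q))) Rinv); [exact C1|].
  apply continuous_Rinv, Rgt_not_eq, flow_z_pos. }
assert (HF : forall t y, is_d_dy D (labelF w v X V) t y (1 / flow_z K t (Z t y))).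
{ intros t' y'.
  apply (is_d_dy_of_global D _ Z (fun q => 1 / flow_z K (fst q) (Z (fst q) (snd q)))); auto.
  - apply is_derive_flow_inv_y.
  - apply (continuous_mult (fun _ => 1)); [apply continuous_const | apply Cinv]. }
(* [HF] provides a value satisfying the specification, so the epsilon choice satisfies it too, and
   uniqueness makes the two equal. *)
assert (Er : forall t y, D (t, y) -> rho t y = 1 / flow_z K t (Z t y)).
{ intros t' y' H; apply HD in H.
  apply (is_d_dy_unique D (labelF w v X V) t' y'); auto.
  - now apply (flow_strip_accumulation K).
  - apply (epsilon_spec (inhabits 0) (is_d_dy D (labelF w v X V) t' y')).
    eexists; apply HF. }
assert (Eir : forall t y, D (t, y) -> 1 / rho t y = flow_z K t (Z t y)).
{ intros t' y' H; rewrite Er by auto; field; apply Rgt_not_eq, flow_z_pos. }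
assert (Ep : forall t y, D (t, y) -> p t y = - w ^ 2 * flow_z K t (Z t y) + C).
{ intros t' y' H; unfold p, pressure; fold rho; rewrite <- Eir by auto.
  unfold Rdiv; ring. }
assert (Hty : D (t, y)) by (split; auto).
assert (P := flow_z_pos K t (Z t y)).
destruct (continuous_flow_derivs K (t, y)) as (C1 & C2 & C3 & C4).
split; [rewrite Er by auto; apply HF|].
split; [rewrite Er by auto; apply Rgt_not_eq, Rdiv_lt_0_compat; lra|].
exists (speed K ^ 2 * flow_zz K t (Z t y)
        - flow_t K t (Z t y) * flow_tz K t (Z t y) / flow_z K t (Z t y)),
  (flow_tz K t (Z t y) / flow_z K t (Z t y)),
  (flow_zz K t (Z t y) / flow_z K t (Z t y)),
  (- w ^ 2 * (flow_zz K t (Z t y) / flow_z K t (Z t y))).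
assert (Czz : continuous (fun q => flow_zz K (fst q) (Z (fst q) (snd q))
                                   / flow_z K (fst q) (Z (fst q) (snd q))) (t, y)).
{ apply (continuous_mult (fun q => flow_zz K (fst q) (Z (fst q) (snd q)))); auto. }
split; [|split; [|split; [|split; [|split]]]].
- apply (is_d_dt_of_global D u (fun t y => flow_t K t (Z t y)) (fun q =>
    speed K ^ 2 * flow_zz K (fst q) (Z (fst q) (snd q))
    - flow_t K (fst q) (Z (fst q) (snd q)) * flow_tz K (fst q) (Z (fst q) (snd q))
      / flow_z K (fst q) (Z (fst q) (snd q)))); auto.
  + apply is_derive_velocity_t.
  + apply (continuous_minus (fun q => speed K ^ 2 * flow_zz K (fst q) (Z (fst q) (snd q)))).
    * now apply (continuous_scal_r (speed K ^ 2)
        (fun q : R * R => flow_zz K (fst q) (Z (fst q) (snd q)))).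
    * apply (continuous_mult (fun q => flow_t K (fst q) (Z (fst q) (snd q))
        * flow_tz K (fst q) (Z (fst q) (snd q)))); auto.
      now apply (continuous_mult (fun q : R * R => flow_t K (fst q) (Z (fst q) (snd q)))).
- apply (is_d_dy_of_global D u (fun t y => flow_t K t (Z t y)) (fun q =>
    flow_tz K (fst q) (Z (fst q) (snd q)) / flow_z K (fst q) (Z (fst q) (snd q)))); auto.
  + apply is_derive_velocity_y.
  + apply (continuous_mult (fun q => flow_tz K (fst q) (Z (fst q) (snd q)))); auto.
- apply (is_d_dy_of_global D _ (fun t y => flow_z K t (Z t y)) (fun q =>
    flow_zz K (fst q) (Z (fst q) (snd q)) / flow_z K (fst q) (Z (fst q) (snd q)))); auto.
  apply is_derive_stretch_y.
- apply (is_d_dy_of_global D p (fun t y => - w ^ 2 * flow_z K t (Z t y) + C) (fun q =>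
    - w ^ 2 * (flow_zz K (fst q) (Z (fst q) (snd q)) / flow_z K (fst q) (Z (fst q) (snd q))))); auto.
  + intros t' y'; evar_last.
    * apply @is_derive_plus; [|apply @is_derive_const].
      apply (is_derive_scal (fun s => flow_z K t' (Z t' s))).
      apply is_derive_stretch_y.
    * apply Rplus_0_r.
  + now apply (continuous_scal_r (- w ^ 2) (fun q : R * R =>
      flow_zz K (fst q) (Z (fst q) (snd q)) / flow_z K (fst q) (Z (fst q) (snd q)))).
(* The two terms in [flow_t] times [flow_tz] over [flow_z] cancel, and on the right the factor
   [flow_z] cancels its inverse; both sides are w^2 times [flow_zz]. *)
- rewrite Eu, Eir, EK by auto; field; lra.
- ring.
Qed.
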